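(* For every $d\ge 5$: (B fails) there exists a centrally symmetric convex $d$-polytope $P$ such that for every $d$-dimensional Hanner polytope $H$ there is an index $i\in\{0,\dots,d-1\}$ with $f_i(P)<f_i(H)$; (C fails) there exists a centrally symmetric convex $d$-polytope $P$ such that for every $d$-dimensional Hanner polytope $H$ there is a functional $\alpha\in\mathcal{F}_d$ with $\alpha(P)<\alpha(H)$.
   Context: $f_i(P)$ is the number of $i$-dimensional faces of $P$. For $S=\{i_1<\dots<i_k\}\subseteq\{0,\dots,d-1\}$, $f_S(P)$ is the number of chains of faces $F_1\subset\cdots\subset F_k\subset P$ with $\dim F_j=i_j$. For $\alpha=(\alpha_S)_S\in\mathbb{R}^{2^{\{0,\dots,d-1\}}}$, $\alpha(P)=\sum_S\alpha_S f_S(P)$, and $\mathcal{F}_d$ is the set of all $\alpha$ with $\alpha(P)\ge 0$ for every convex $d$-polytope $P$. A polytope $P$ is centrally symmetric if $P=-P$. Hanner polytopes are defined recursively: every centrally symmetric $1$-dimensional polytope is a Hanner polytope; for $d\ge2$, a $d$-polytope is a Hanner polytope if it is the direct sum $H'\oplus H''=\mathrm{conv}(H'\times\{0\}\cup\{0\}\times H'')$ or the direct product $H'\times H''$ of two lower-dimensional Hanner polytopes. *)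

(* Defs.v *)
From HB Require Import structures.
From mathcomp Require Import all_boot all_order all_algebra finmap.
From mathcomp Require Import all_classical all_reals.

Set Implicit Arguments.
Unset Strict Implicit.
Unset Printing Implicit Defensive.

Import Order.TTheory GRing.Theory Num.Theory.

Local Open Scope classical_set_scope.
Local Open Scope ring_scope.

Definition affine_hull (R : realType) (n : nat) (A : set 'rV[R]_n) :
    set 'rV[R]_n :=
  [set x | exists (m : nat) (p : 'I_m -> 'rV[R]_n) (w : 'I_m -> R),
     [/\ forall i, A (p i), \sum_i w i = 1 & x = \sum_i w i *: p i]].

Definition convex_hull (R : realType) (n : nat) (A : set 'rV[R]_n) :
    set 'rV[R]_n :=
  [set x | exists (m : nat) (p : 'I_m -> 'rV[R]_n) (w : 'I_m -> R),
     [/\ forall i, A (p i), forall i, 0 <= w i, \sum_i w i = 1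
       & x = \sum_i w i *: p i]].

(* The empty set has no dimension here. *)
Definition has_dim (R : realType) (n : nat) (A : set 'rV[R]_n) (k : nat) :
    Prop :=
  exists (x : 'rV[R]_n) (U : {vspace 'rV[R]_n}),
    affine_hull A = [set x + u | u in [set` U]] /\ \dim U = k.

Definition polytope (R : realType) (n : nat) (P : set 'rV[R]_n) : Prop :=
  exists2 A : set 'rV[R]_n, finite_set A & P = convex_hull A.

(* A d-polytope may live in a space R^n with n > d. *)
Definition dpolytope (R : realType) (d n : nat) (P : set 'rV[R]_n) : Prop :=
  polytope P /\ has_dim P d.

Definition centrally_symmetric (R : realType) (n : nat) (P : set 'rV[R]_n) :
    Prop :=
  P = [set - x | x in P].

(* The linear functional with coefficient column c is x |-> (x *m c) 0 0;
   c = 0 gives the improper faces P (b = 0) and set0 (b = 1). *)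
Definition face (R : realType) (n : nat) (P F : set 'rV[R]_n) : Prop :=
  exists (c : 'cV[R]_n) (b : R),
    (forall x, P x -> (x *m c) 0 0 <= b) /\
    F = [set x | P x /\ (x *m c) 0 0 = b].

(* fset_set sends infinite sets to the empty fset; the sets counted in
   f_num and flag_f_num are finite when P is a polytope. *)
Definition f_num (R : realType) (n : nat) (i : nat) (P : set 'rV[R]_n) : nat :=
  #|` fset_set [set F : set 'rV[R]_n | face P F /\ has_dim F i] |.

(* A chain with dimension set S is indexed by the elements of S, the member
   with index i having dimension i. *)
Definition flag_chain (R : realType) (d n : nat) (S : {set 'I_d})
    (P : set 'rV[R]_n) (F : {ffun {i : 'I_d | i \in S} -> set 'rV[R]_n}) :
    Prop :=
  [/\ forall i : {i : 'I_d | i \in S},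
        [/\ face P (F i), has_dim (F i) (val i) & F i `<` P]
    & forall i j : {i : 'I_d | i \in S},
        (val i < val j)%N -> F i `<` F j].

Definition flag_f_num (R : realType) (d n : nat) (S : {set 'I_d})
    (P : set 'rV[R]_n) : nat :=
  #|` fset_set [set F | @flag_chain R d n S P F] |.

Definition flag_functional (R : realType) (d n : nat)
    (alpha : {set 'I_d} -> R) (P : set 'rV[R]_n) : R :=
  \sum_(S : {set 'I_d}) alpha S * (flag_f_num S P)%:R.

Definition nonneg_functionals (R : realType) (d : nat) :
    set ({set 'I_d} -> R) :=
  [set alpha | forall (n : nat) (P : set 'rV[R]_n),
     dpolytope d P -> 0 <= flag_functional alpha P].

Definition direct_product (R : realType) (m n : nat)
    (A : set 'rV[R]_m) (B : set 'rV[R]_n) : set 'rV[R]_(m + n) :=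
  [set row_mx x y | x in A & y in B].

Definition direct_sum (R : realType) (m n : nat)
    (A : set 'rV[R]_m) (B : set 'rV[R]_n) : set 'rV[R]_(m + n) :=
  convex_hull (direct_product A [set 0] `|` direct_product [set 0] B).

(* The two components of a sum or product automatically have smaller
   dimension, since every Hanner polytope has dimension at least 1. *)
Inductive hanner (R : realType) : forall n : nat, set 'rV[R]_n -> Prop :=
| hanner_segment (n : nat) (P : set 'rV[R]_n) :
    dpolytope 1 P -> centrally_symmetric P -> hanner P
| hanner_sum (m n : nat) (H1 : set 'rV[R]_m) (H2 : set 'rV[R]_n) :
    hanner H1 -> hanner H2 -> hanner (direct_sum H1 H2)
| hanner_product (m n : nat) (H1 : set 'rV[R]_m) (H2 : set 'rV[R]_n) :
    hanner H1 -> hanner H2 -> hanner (direct_product H1 H2).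

(* Main.v *)
(** Let P be the slice of the cube [-1, 1]^(d+1) by the hyperplane where the first
six coordinates sum to zero, i.e. the product of the hypersimplex Delta(3, 6) and
a (d-5)-cube. It has 20 * 2^(d-5) vertices and 2(d+1) facets. By induction on its
construction, a Hanner d-polytope with at most 2d + 2 facets has at least
(3/4) 2^d = 24 * 2^(d-5) vertices: under a product the vertex numbers multiply and
the facet numbers add, and dually for a sum, which forces the factors of a sum with
so few facets to have total dimension at most 3. So every Hanner polytope has more
vertices or more facets than P. As the functionals f_0 and f_(d-1) are nonnegative
on all polytopes, P refutes both conjectures. *)

Require Import Defs.
From mathcomp Require Import all_boot all_order all_algebra finmap.
From mathcomp Require Import all_classical all_reals.
From mathcomp Require Import ring lra zify.

Set Implicit Arguments.
Unset Strict Implicit.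
Unset Printing Implicit Defensive.

Import Order.TTheory GRing.Theory Num.Theory.

Local Open Scope classical_set_scope.
Local Open Scope ring_scope.

(** * Affine and convex hulls, faces *)

(** Face numbers are only estimated, each in the one direction that matters: from below for Hanner
    polytopes, by injecting products and joins of faces, and from above for the slice, by covering
    its vertices and facets. No face lattice is ever determined. Six is the least even number of
    coordinates for which such a slice helps: four coordinates give the hypersimplex Delta(2, 4), an
    octahedron, which is itself a Hanner polytope and attains the ratio 3/4. This is where d >= 5
    comes from. The slice loses one dimension but keeps two bounds for each of the d+1 coordinates,
    so it has two facets more than the minimum 2d of a Hanner d-polytope; the induction distributes
    this excess of two over the factors. Central symmetry enters through the origin: it lies
    strictly below every proper face, so that proper faces of the summands can be joined to faces of
    a direct sum. *)

Definition evaluation (R : realType) (n : nat) (c : 'cV[R]_n) (x : 'rV[R]_n) : R :=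
  (x *m c) 0 0.

Lemma evaluationD (R : realType) (n : nat) (c : 'cV[R]_n) x y :
  evaluation c (x + y) = evaluation c x + evaluation c y.
Proof. by rewrite /evaluation mulmxDl mxE. Qed.

Lemma evaluationZ (R : realType) (n : nat) (c : 'cV[R]_n) a x :
  evaluation c (a *: x) = a * evaluation c x.
Proof. by rewrite /evaluation -scalemxAl mxE. Qed.

Lemma evaluationN (R : realType) (n : nat) (c : 'cV[R]_n) x :
  evaluation c (- x) = - evaluation c x.
Proof. by rewrite /evaluation mulNmx mxE. Qed.

Lemma evaluation_at0 (R : realType) (n : nat) (c : 'cV[R]_n) :
  evaluation c 0 = 0.
Proof. by rewrite /evaluation mul0mx mxE. Qed.

Lemma evaluation_scale (R : realType) (n : nat) (c : 'cV[R]_n) a x :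
  evaluation (a *: c) x = a * evaluation c x.
Proof. by rewrite /evaluation -scalemxAr mxE. Qed.

Lemma evaluation_col_mx (R : realType) (m n : nat) (c : 'cV[R]_m)
    (e : 'cV[R]_n) x y :
  evaluation (col_mx c e) (row_mx x y) = evaluation c x + evaluation e y.
Proof. by rewrite /evaluation mul_row_col mxE. Qed.

(** The three-point form makes directions [b - c] available at every base point [a], so directions
    can be added up without halving. *)
Definition affine_closed (R : realType) (n : nat) (S : set 'rV[R]_n) :=
  forall a b c t, S a -> S b -> S c -> S (a + t *: (b - c)).

Definition convex (R : realType) (n : nat) (S : set 'rV[R]_n) :=
  forall x y s t, 0 <= s -> 0 <= t -> s + t = 1 ->
    S x -> S y -> S (s *: x + t *: y).

(* Weighted sums of points of A of total weight s, the weights being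
   nonnegative when pos holds: the homogenised affine and convex hulls. *)
Definition weighted_sum (R : realType) (n : nat) (pos : bool)
    (A : set 'rV[R]_n) (s : R) (x : 'rV[R]_n) : Prop :=
  exists (m : nat) (p : 'I_m -> 'rV[R]_n) (w : 'I_m -> R),
    [/\ forall i, A (p i), forall i, pos -> 0 <= w i, \sum_i w i = s
      & x = \sum_i w i *: p i].

Lemma weighted_sumD (R : realType) (n : nat) (pos : bool) (A : set 'rV[R]_n) s t x y :
  weighted_sum pos A s x -> weighted_sum pos A t y ->
  weighted_sum pos A (s + t) (x + y).
Proof.
move=> [m [p [w [Ap w0 <- ->]]]] [k [q [v [Aq v0 <- ->]]]].
exists (m + k)%N, (fun i => match fintype.split i with inl j => p j | inr j => q j end),
  (fun i => match fintype.split i with inl j => w j | inr j => v j end); split.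
- by move=> i; case: (fintype.split i).
- by move=> i; case: (fintype.split i).
- rewrite big_split_ord /=; congr (_ + _); apply: eq_bigr => i _.
    by rewrite -[lshift k i]/(unsplit (inl i)) unsplitK.
  by rewrite -[rshift m i]/(unsplit (inr i)) unsplitK.
- rewrite big_split_ord /=; congr (_ + _); apply: eq_bigr => i _.
    by rewrite -[lshift k i]/(unsplit (inl i)) unsplitK.
  by rewrite -[rshift m i]/(unsplit (inr i)) unsplitK.
Qed.

Lemma weighted_sumZ (R : realType) (n : nat) (pos : bool) (A : set 'rV[R]_n) (a s : R) x :
  (pos -> 0 <= a) -> weighted_sum pos A s x ->
  weighted_sum pos A (a * s) (a *: x).
Proof.
move=> a0 [m [p [w [Ap w0 <- ->]]]]; exists m, p, (fun i => a * w i); split => //.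
- by move=> i hp; rewrite mulr_ge0 ?w0 ?a0.
- by rewrite mulr_sumr.
- by rewrite scaler_sumr; apply: eq_bigr => i _; rewrite scalerA.
Qed.

Lemma weighted_sum1 (R : realType) (n : nat) (pos : bool) (A : set 'rV[R]_n) x :
  A x -> weighted_sum pos A 1 x.
Proof.
move=> Ax; exists 1%N, (fun=> x), (fun=> 1); split => //.
- by rewrite big_ord1.
- by rewrite big_ord1 scale1r.
Qed.

Lemma affine_hullE (R : realType) (n : nat) (A : set 'rV[R]_n) x :
  affine_hull A x <-> weighted_sum false A 1 x.
Proof.
split=> -[m [p [w]]].
  by case=> ? ? ?; exists m, p, w; split.
by case=> ? ? ? ?; exists m, p, w; split.
Qed.

Lemma convex_hullE (R : realType) (n : nat) (A : set 'rV[R]_n) x :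
  convex_hull A x <-> weighted_sum true A 1 x.
Proof.
split=> -[m [p [w]]].
  by case=> ? ? ? ?; exists m, p, w; split.
by case=> ? w0 ? ?; exists m, p, w; split => // i; exact: w0.
Qed.

Lemma sub_affine_hull (R : realType) (n : nat) (A : set 'rV[R]_n) :
  A `<=` affine_hull A.
Proof. by move=> x Ax; apply/affine_hullE; exact: weighted_sum1. Qed.

Lemma sub_convex_hull (R : realType) (n : nat) (A : set 'rV[R]_n) :
  A `<=` convex_hull A.
Proof. by move=> x Ax; apply/convex_hullE; exact: weighted_sum1. Qed.

Lemma affine_hull_closed (R : realType) (n : nat) (A : set 'rV[R]_n) :
  affine_closed (affine_hull A).
Proof.
move=> a b c t /affine_hullE ha /affine_hullE hb /affine_hullE hc.
apply/affine_hullE; have -> : 1 = 1 + (t * 1 + (- t) * 1) :> R by ring.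
by rewrite scalerBr -scaleNr; do 2?apply: weighted_sumD => //;
  apply: weighted_sumZ.
Qed.

Lemma convex_hull_convex (R : realType) (n : nat) (A : set 'rV[R]_n) :
  convex (convex_hull A).
Proof.
move=> x y s t s0 t0 st /convex_hullE hx /convex_hullE hy.
apply/convex_hullE; rewrite -st -[s in s + _]mulr1 -[t in _ + t]mulr1.
by apply: weighted_sumD; apply: weighted_sumZ.
Qed.

Lemma affine_hull_min (R : realType) (n : nat) (A S : set 'rV[R]_n) :
  A `<=` S -> affine_closed S -> affine_hull A `<=` S.
Proof.
move=> AS Sc x [[|m]] [p [w [Ap w1 ->]]].
  by move: w1; rewrite big_ord0 => /esym/eqP; rewrite oner_eq0.
(* Relative to the base point [p ord0] the total weight no longer matters, so the terms can be added
   one at a time without leaving [S]. *)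
have -> : \sum_i w i *: p i = p ord0 + \sum_i w i *: (p i - p ord0).
  under [X in _ = _ + X]eq_bigr do rewrite scalerBr.
  by rewrite sumrB -scaler_suml w1 scale1r addrC subrK.
apply: (big_ind (fun y => S (p ord0 + y))).
- by rewrite addr0; exact/AS.
- move=> y z Sy Sz.
  have -> : p ord0 + (y + z) = (p ord0 + y) + 1 *: ((p ord0 + z) - p ord0).
    by rewrite scale1r [p ord0 + z]addrC addrK addrA.
  by apply: Sc => //; exact/AS.
- by move=> i _; apply: Sc; exact/AS.
Qed.

Lemma convex_hull_min (R : realType) (n : nat) (A S : set 'rV[R]_n) :
  A `<=` S -> convex S -> convex_hull A `<=` S.
Proof.
move=> AS Sc x [m [p [w [Ap w0 w1 ->]]]].
(* Partial sums of the weights need not be 1, so the induction runs over normalised sums of positive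
   total weight. *)
suff H : 0 < \sum_i w i -> S ((\sum_i w i)^-1 *: \sum_i w i *: p i).
  by move: H; rewrite w1 invr1 scale1r; apply.
elim: m p w Ap w0 {w1 x} => [|m IH] p w Ap w0; first by rewrite big_ord0 ltxx.
rewrite !big_ord_recl /=.
set s := \sum_(i < m) w (lift ord0 i).
set y := \sum_(i < m) w (lift ord0 i) *: p (lift ord0 i).
have s0 : 0 <= s by apply: sumr_ge0.
have [s_eq0|s_neq0] := eqVneq s 0.
  have -> : y = 0.
    apply: big1 => i _; rewrite (_ : w _ = 0) ?scale0r//.
    by apply: (psumr_eq0P _ s_eq0) => // j _.
  rewrite s_eq0 !addr0 => wgt0.
  by rewrite scalerA mulVf ?gt_eqF// scale1r; exact/AS.
move=> sgt0; have {}s_gt0 : 0 < s by rewrite lt_neqAle eq_sym s_neq0.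
have Sy : S (s^-1 *: y) by apply: (IH (p \o lift ord0) (w \o lift ord0)) => //= i.
rewrite scalerDr scalerA.
rewrite [X in _ + X](_ : _ = ((w ord0 + s)^-1 * s) *: (s^-1 *: y)); last first.
  by rewrite !scalerA -mulrA divff ?mulr1.
apply: Sc => //; last exact/AS.
- by rewrite mulr_ge0 ?invr_ge0 ?addr_ge0.
- by rewrite mulr_ge0 ?invr_ge0 ?addr_ge0.
- by rewrite -mulrDr mulVf// gt_eqF.
Qed.

Lemma convex_hull_id (R : realType) (n : nat) (S : set 'rV[R]_n) :
  convex S -> convex_hull S = S.
Proof.
move=> Sc; apply/seteqP; split; last exact: sub_convex_hull.
exact: convex_hull_min.
Qed.

Lemma convex_hull_mono (R : realType) (n : nat) (A B : set 'rV[R]_n) :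
  A `<=` B -> convex_hull A `<=` convex_hull B.
Proof.
move=> AB; apply: convex_hull_min (@convex_hull_convex _ _ _).
by move=> x /AB; exact: sub_convex_hull.
Qed.

Lemma affine_closed_convex (R : realType) (n : nat) (S : set 'rV[R]_n) :
  affine_closed S -> convex S.
Proof.
move=> Sc x y s t _ _ st Sx Sy.
have -> : s *: x + t *: y = x + t *: (y - x); last exact: Sc.
by rewrite (_ : s = 1 - t) ?scalerBl ?scale1r ?scalerBr -?addrA ?[- _ + _]addrC//; lra.
Qed.

Lemma affine_hull_convex_hull (R : realType) (n : nat) (A : set 'rV[R]_n) :
  affine_hull (convex_hull A) = affine_hull A.
Proof.
apply/seteqP; split; apply: affine_hull_min (@affine_hull_closed _ _ _).
- apply: convex_hull_min; first exact: sub_affine_hull.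
  exact: affine_closed_convex (@affine_hull_closed _ _ _).
- by move=> x Ax; apply: sub_affine_hull; exact: sub_convex_hull.
Qed.

Lemma polytope_convex (R : realType) (n : nat) (P : set 'rV[R]_n) :
  polytope P -> convex P.
Proof. by case=> A _ ->; exact: convex_hull_convex. Qed.

Lemma convex_level (R : realType) (n : nat) (P : set 'rV[R]_n) c b :
  convex P -> convex [set x | P x /\ evaluation c x = b].
Proof.
move=> Pc x y s t s0 t0 st [Px xb] [Py yb]; split; first exact: Pc.
by rewrite evaluationD !evaluationZ xb yb -mulrDl st mul1r.
Qed.

Lemma evaluation_level_closed (R : realType) (n : nat) (c : 'cV[R]_n) b :
  affine_closed [set x | evaluation c x = b].
Proof.
move=> x y z t /= xb yb zb.
by rewrite evaluationD evaluationZ evaluationD evaluationN xb yb zb subrr mulr0 addr0.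
Qed.

Lemma evaluation_convex_hull_le (R : realType) (n : nat) (A : set 'rV[R]_n) c b :
  (forall x, A x -> evaluation c x <= b) ->
  forall x, convex_hull A x -> evaluation c x <= b.
Proof.
move=> Ab; apply: (@convex_hull_min _ _ A [set x | evaluation c x <= b]) => //.
move=> x y s t s0 t0 st /= xb yb; rewrite evaluationD !evaluationZ.
by rewrite -[b]mul1r -st mulrDl lerD// ler_wpM2l.
Qed.

Lemma face_convex_hull (R : realType) (n : nat) (A : set 'rV[R]_n) c b :
  (forall x, A x -> evaluation c x <= b) ->
  [set x | convex_hull A x /\ evaluation c x = b] =
  convex_hull [set x | A x /\ evaluation c x = b].
Proof.
move=> Ab; apply/seteqP; split => [x [Ax xb]|]; last first.
  apply: convex_hull_min; last exact: convex_level (@convex_hull_convex _ _ _).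
  by move=> x [Ax xb]; split => //; exact: sub_convex_hull.
(* Lying on level [b] is not inherited by the parts of a convex combination unless these are known
   to lie below [b]; the bound is therefore carried along with the implication. *)
suff [_] : evaluation c x <= b /\ (evaluation c x = b ->
  convex_hull [set x | A x /\ evaluation c x = b] x) by apply.
move: x Ax {xb}; apply: (@convex_hull_min _ _ A [set x | evaluation c x <= b /\
  (evaluation c x = b -> convex_hull [set x | A x /\ evaluation c x = b] x)]).
  by move=> x Ax; split; [exact: Ab|move=> xb; exact: sub_convex_hull].
move=> x y s t s0 t0 st [xb Hx] [yb Hy]; split.
  rewrite evaluationD !evaluationZ -[b]mul1r -st mulrDl lerD// ler_wpM2l//.
rewrite evaluationD !evaluationZ => e.
have [s_eq0|s_neq0] := eqVneq s 0.
  move: st e; rewrite s_eq0 !add0r => -> e.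
  by rewrite scale0r scale1r add0r; apply: Hy; move: e; lra.
have [t_eq0|t_neq0] := eqVneq t 0.
  move: st e; rewrite t_eq0 !addr0 => -> e.
  by rewrite scale0r scale1r addr0; apply: Hx; move: e; lra.
have /eqP : s * (b - evaluation c x) + t * (b - evaluation c y) = 0.
  transitivity ((s + t) * b - (s * evaluation c x + t * evaluation c y)).
    by ring.
  by rewrite st e mul1r subrr.
rewrite paddr_eq0 ?mulr_ge0 ?subr_ge0// !mulf_eq0 (negPf s_neq0) (negPf t_neq0) /=.
rewrite !subr_eq0 => /andP[/eqP ex /eqP ey].
by apply: convex_hull_convex => //; [exact: Hx|exact: Hy].
Qed.

(** A face is thus determined by the generators on it, which leaves only finitely many faces. *)
Lemma face_polytope (R : realType) (n : nat) (A F : set 'rV[R]_n) :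
  face (convex_hull A) F -> F = convex_hull (A `&` F).
Proof.
move=> [c [b [cb ->]]]; rewrite face_convex_hull; last first.
  by move=> x Ax; apply: cb; exact: sub_convex_hull.
congr convex_hull; apply/seteqP; split => x [Ax xb]; split => //.
  exact: sub_convex_hull (conj Ax xb).
suff : evaluation c x = b by [].
apply: (@convex_hull_min _ _ _ [set x | evaluation c x = b]) xb; first by move=> y [].
exact: affine_closed_convex (@evaluation_level_closed _ _ _ _).
Qed.

Lemma face_sub (R : realType) (n : nat) (P F : set 'rV[R]_n) :
  face P F -> F `<=` P.
Proof. by move=> [c [b [_ ->]]] x []. Qed.

Lemma face_refl (R : realType) (n : nat) (P : set 'rV[R]_n) : face P P.
Proof.
exists 0, 0; split=> [x _|]; first by rewrite mulmx0 mxE.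
by apply/seteqP; split => x; [move=> Px; rewrite /= mulmx0 mxE|case].
Qed.

(** The supporting functional is constant on the affine hull of the face. This later recovers a
    facet from its affine hull alone. *)
Lemma face_affine_hull (R : realType) (n : nat) (P F : set 'rV[R]_n) :
  face P F -> F = P `&` affine_hull F.
Proof.
move=> fF; apply/seteqP; split => x.
  by move=> Fx; split; [exact: face_sub fF _ Fx|exact: sub_affine_hull].
move=> [Px]; move: fF => [c [b [cb ->]]] Fx; split => //.
apply: (affine_hull_min (S := [set x | evaluation c x = b])) Fx.
  by move=> y [].
exact: evaluation_level_closed.
Qed.

Lemma finite_subsets (T : choiceType) (A : set T) :
  finite_set A -> finite_set [set B | B `<=` A].
Proof.
move=> fA.
have : finite_set [set [set` X] | X in [set` fpowerset (fset_set A)]].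
  exact/finite_image/finite_fset.
apply: sub_finite_set => B BA; have fB := sub_finite_set BA fA.
exists (fset_set B); last by rewrite fset_setK.
by rewrite /= fpowersetE -fset_set_sub.
Qed.

Lemma finite_faces (R : realType) (n : nat) (P : set 'rV[R]_n) :
  polytope P -> finite_set [set F | face P F].
Proof.
move=> [A fA ->].
have : finite_set [set convex_hull B | B in [set B | B `<=` A]].
  exact/finite_image/finite_subsets.
apply: sub_finite_set => F fF; exists (A `&` F); first by move=> x [].
by rewrite -face_polytope.
Qed.

Lemma finite_faces_dim (R : realType) (n : nat) (P : set 'rV[R]_n) k :
  polytope P -> finite_set [set F | face P F /\ has_dim F k].
Proof. by move/finite_faces; apply: sub_finite_set => F []. Qed.

(** * Dimension *)

(** With the direction space as the row space of a matrix of full row rank, dimensions become ranks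
    and membership becomes [submx]. *)
Lemma has_dimP (R : realType) (n : nat) (A : set 'rV[R]_n) k :
  has_dim A k <-> exists (x : 'rV[R]_n) (M : 'M[R]_(k, n)),
    row_free M /\ forall y, affine_hull A y <-> (y - x <= M)%MS.
Proof.
split=> [[x [U [AU <-]]]|[x [M [freeM AM]]]].
  exists x, (\matrix_(i < \dim U) (vbasis U)`_i); split.
    apply: inj_row_free => v; rewrite mulmx_sum_row => v0.
    apply/rowP => i; rewrite [RHS]mxE.
    apply: (freeP (basis_free (vbasisP U)) (fun i => v 0 i)).
    by rewrite -[RHS]v0; apply: eq_bigr => j _; rewrite rowK.
  have memU v : v \in U <-> (v <= \matrix_(i < \dim U) (vbasis U)`_i)%MS.
    split=> [/coord_vbasis ->|/submxP[D ->]].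
      apply: summx_sub => i _; apply: scalemx_sub.
      by rewrite -[_`_i](rowK (fun i : 'I__ => (vbasis U)`_i)) row_sub.
    rewrite mulmx_sum_row; apply: memv_suml => i _; apply: memvZ.
    by rewrite rowK; apply: vbasis_mem; rewrite mem_nth ?size_tuple.
  move=> y; rewrite AU -memU; split=> [[u Uu <-]|yU]; first by rewrite addrC addKr.
  by exists (y - x) => //; rewrite addrC subrK.
exists x, (limg (linfun (mulmxr M))); split.
  apply/seteqP; split => y.
    move=> /AM /submxP[D yD]; exists (y - x); last by rewrite addrC subrK.
    rewrite /= yD; have := memv_img (linfun (mulmxr M)) (memvf D).
    by rewrite lfunE.
  move=> [u /memv_imgP[D _ ->] <-]; apply/AM.
  by rewrite lfunE /= addrC addKr submxMl.
rewrite limg_dim_eq ?dimvf /=; first by rewrite /dim /= mul1n.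
apply/eqP; rewrite capfv -subv0; apply/subvP => v.
rewrite memv_ker lfunE /= memv0 => /eqP vM; apply/eqP.
by apply: (row_free_inj freeM); rewrite vM mul0mx.
Qed.

Lemma eq_has_dim (R : realType) (n : nat) (A B : set 'rV[R]_n) k :
  affine_hull A = affine_hull B -> has_dim A k -> has_dim B k.
Proof. by rewrite /has_dim => ->. Qed.

Lemma submx_shift (R : realType) (n m : nat) (N : 'M[R]_(m, n)) (x y z : 'rV[R]_n) :
  (x - z <= N)%MS -> (y - x <= N)%MS = (y - z <= N)%MS.
Proof.
move=> xz; apply/idP/idP => h; last first.
  have -> : y - x = (y - z) - (x - z) by rewrite opprB addrA subrK.
  by rewrite addmx_sub ?eqmx_opp.
have -> : y - z = (y - x) + (x - z) by rewrite addrA subrK.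
exact: addmx_sub.
Qed.

Lemma coset_closed (R : realType) (n m : nat) (N : 'M[R]_(m, n)) (x : 'rV[R]_n) :
  affine_closed [set y | (y - x <= N)%MS].
Proof.
move=> a b c t /= ha hb hc.
have -> : a + t *: (b - c) - x = (a - x) + t *: ((b - x) - (c - x)).
  by rewrite opprB [(_ - x) + (x - c)]addrA subrK addrAC.
apply: addmx_sub => //; apply: scalemx_sub; apply: addmx_sub => //.
by rewrite eqmx_opp.
Qed.

(** The direction space of [A] has dimension [k] and lies in the row space of [N], whose rank is at
    most [k], so the two coincide. *)
Lemma has_dim_sup (R : realType) (n m k : nat) (A : set 'rV[R]_n) x
    (N : 'M[R]_(m, n)) :
  has_dim A k -> A x -> (forall y, A y -> (y - x <= N)%MS) ->
  (\rank N <= k)%N -> forall y, affine_hull A y <-> (y - x <= N)%MS.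
Proof.
move=> /has_dimP[x0 [M [/eqP rM AM]]] Ax AN rN.
have x0x : (x - x0 <= M)%MS by apply/AM; exact: sub_affine_hull.
have MN : (M <= N)%MS.
  apply/row_subP => i.
  have : affine_hull A (x + row i M).
    by apply/AM; rewrite -(submx_shift _ x0x) addrC addKr row_sub.
  move/(@affine_hull_min _ _ _ _ AN (@coset_closed _ _ _ _ _)).
  by rewrite /= addrC addKr.
have NM : (N <= M)%MS by rewrite -(mxrank_leqif_sup MN) eqn_leq mxrankS// rM.
move=> y; rewrite AM -(submx_shift _ x0x).
by split=> /submx_trans; apply.
Qed.

Lemma has_dim_nonempty (R : realType) (n : nat) (A : set 'rV[R]_n) k :
  has_dim A k -> exists x, A x.
Proof.
move=> /has_dimP[x [M [_ AM]]].
have /AM : (x - x <= M)%MS by rewrite subrr sub0mx.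
move=> [[|m] [p [w [Ap w1 _]]]]; last by exists (p ord0).
by move: w1; rewrite big_ord0 => /esym/eqP; rewrite oner_eq0.
Qed.

Lemma has_dim_uniq (R : realType) (n : nat) (A : set 'rV[R]_n) k l :
  has_dim A k -> has_dim A l -> k = l.
Proof.
move=> Ak Al; have [x Ax] := has_dim_nonempty Ak.
have /has_dimP[y [M [/eqP rM AM]]] := Ak.
have /has_dimP[z [N [/eqP rN AN]]] := Al.
have xz : (x - z <= N)%MS by apply/AN; exact: sub_affine_hull.
have xy : (x - y <= M)%MS by apply/AM; exact: sub_affine_hull.
have H (u : 'rV[R]_n) : (u <= M)%MS <-> (u <= N)%MS.
  transitivity (affine_hull A (x + u)).
    by rewrite AM -(submx_shift _ xy) [x + u]addrC addrK.
  by rewrite AN -(submx_shift _ xz) [x + u]addrC addrK.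
rewrite -rM -rN; apply/eqP; rewrite eqn_leq; apply/andP; split; apply: mxrankS;
  by apply/row_subP => i; apply/H; rewrite row_sub.
Qed.

Lemma has_dim_set1 (R : realType) (n : nat) (v : 'rV[R]_n) : has_dim [set v] 0.
Proof.
apply/has_dimP; exists v, 0; split; first by rewrite /row_free mxrank0.
move=> y; split; last first.
  by move=> /submx0null/eqP; rewrite subr_eq0 => /eqP ->; exact: sub_affine_hull.
suff H : affine_hull [set v] y -> y = v by move=> /H ->; rewrite subrr sub0mx.
apply: (@affine_hull_min _ _ _ [set v]) => //.
by move=> a b c t -> -> ->; rewrite subrr scaler0 addr0.
Qed.

Lemma has_dim0_set1 (R : realType) (n : nat) (A : set 'rV[R]_n) :
  has_dim A 0 -> exists v, A = [set v].
Proof.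
move=> A0; have [v Av] := has_dim_nonempty A0.
have /has_dimP[x [M [_ AM]]] := A0; exists v.
have H y : A y -> y = x.
  move=> /sub_affine_hull/AM; rewrite [M]flatmx0 => /submx0null/eqP.
  by rewrite subr_eq0 => /eqP.
by apply/seteqP; split => y; [move=> Ay; rewrite /= (H _ Ay) (H _ Av)|move=> ->].
Qed.

Lemma affine_hull_product (R : realType) (m n : nat) (A : set 'rV[R]_m)
    (B : set 'rV[R]_n) :
  affine_hull (direct_product A B) = direct_product (affine_hull A) (affine_hull B).
Proof.
apply/seteqP; split.
  apply: affine_hull_min.
    move=> _ [x Ax [y By <-]]; exists x; first exact: sub_affine_hull.
    by exists y => //; exact: sub_affine_hull.
  move=> _ _ _ t [x1 A1 [y1 B1 <-]] [x2 A2 [y2 B2 <-]] [x3 A3 [y3 B3 <-]].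
  exists (x1 + t *: (x2 - x3)); first exact: affine_hull_closed.
  exists (y1 + t *: (y2 - y3)); first exact: affine_hull_closed.
  by rewrite opp_row_mx add_row_mx scale_row_mx add_row_mx.
move=> _ [x Ax [y By <-]].
have HA a : A a -> affine_hull B `<=`
    [set y | affine_hull (direct_product A B) (row_mx a y)].
  move=> Aa; apply: affine_hull_min => [b Bb|b1 b2 b3 t h1 h2 h3] /=.
    by apply: sub_affine_hull; exists a => //; exists b.
  have -> : row_mx a (b1 + t *: (b2 - b3)) =
      row_mx a b1 + t *: (row_mx a b2 - row_mx a b3).
    by rewrite opp_row_mx add_row_mx scale_row_mx add_row_mx subrr scaler0 addr0.
  exact: affine_hull_closed.
move: x Ax; apply: affine_hull_min => [a Aa|a1 a2 a3 t h1 h2 h3].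
  exact: HA.
suff -> : row_mx (a1 + t *: (a2 - a3)) y =
    row_mx a1 y + t *: (row_mx a2 y - row_mx a3 y) by exact: affine_hull_closed.
by rewrite opp_row_mx add_row_mx scale_row_mx add_row_mx subrr scaler0 addr0.
Qed.

Lemma sub_block_diag_mx (R : realType) (m n k l : nat) (M : 'M[R]_(k, m))
    (N : 'M[R]_(l, n)) (x : 'rV[R]_m) (y : 'rV[R]_n) :
  (row_mx x y <= block_mx M 0 0 N)%MS = (x <= M)%MS && (y <= N)%MS.
Proof.
apply/idP/andP => [/submxP[D]|[/submxP[D ->] /submxP[E ->]]].
  rewrite -(hsubmxK D) mul_row_block !mulmx0 addr0 add0r => /eq_row_mx[-> ->].
  by rewrite !submxMl.
apply/submxP; exists (row_mx D E).
by rewrite mul_row_block !mulmx0 addr0 add0r.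
Qed.

Lemma has_dim_product (R : realType) (m n : nat) (A : set 'rV[R]_m)
    (B : set 'rV[R]_n) k l :
  has_dim A k -> has_dim B l -> has_dim (direct_product A B) (k + l).
Proof.
move=> /has_dimP[x [M [/eqP rM AM]]] /has_dimP[y [N [/eqP rN BN]]].
apply/has_dimP; exists (row_mx x y), (block_mx M 0 0 N); split.
  by rewrite /row_free rank_diag_block_mx rM rN.
move=> z; rewrite affine_hull_product -(hsubmxK z).
rewrite opp_row_mx add_row_mx sub_block_diag_mx; split.
  by move=> [a /AM Aa [b /BN Bb /eq_row_mx[<- <-]]]; apply/andP.
by move=> /andP[/AM Aa /BN Bb]; exists (lsubmx z) => //; exists (rsubmx z).
Qed.

(** The two affine hulls are skew, which accounts for the extra 1: the functional [c] vanishes on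
    the directions of [A] but not on the direction that joins the hulls. *)
Lemma has_dim_join (R : realType) (m n : nat) (A : set 'rV[R]_m)
    (B : set 'rV[R]_n) k l (c : 'cV[R]_m) :
  has_dim A k -> has_dim B l -> (forall x, A x -> evaluation c x = 1) ->
  has_dim (convex_hull (direct_product A [set 0] `|` direct_product [set 0] B))
    (k + l + 1).
Proof.
move=> /has_dimP[x [M [freeM AM]]] /has_dimP[y [N [freeN BN]]] Ac.
have affc z : affine_hull A z -> evaluation c z = 1.
  exact: (@affine_hull_min _ _ _ [set z | evaluation c z = 1] Ac
    (@evaluation_level_closed _ _ _ _)).
have xA : affine_hull A x by apply/AM; rewrite subrr sub0mx.
have cM v : evaluation c (v *m M) = 0.
  have : affine_hull A (x + v *m M) by apply/AM; rewrite addrC addKr submxMl.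
  by move/affc; rewrite evaluationD affc//; lra.
set S := direct_product A [set 0] `|` direct_product [set 0] B.
have SA z : affine_hull A z -> affine_hull S (row_mx z 0).
  move: z; apply: affine_hull_min => [z Az|z1 z2 z3 t h1 h2 h3].
    by apply: sub_affine_hull; left; exists z => //; exists 0.
  suff -> : row_mx (z1 + t *: (z2 - z3)) 0 = row_mx z1 0 +
      t *: (row_mx z2 0 - row_mx z3 (0 : 'rV_n)) by exact: affine_hull_closed.
  by rewrite opp_row_mx add_row_mx scale_row_mx add_row_mx subrr scaler0 addr0.
have SB z : affine_hull B z -> affine_hull S (row_mx 0 z).
  move: z; apply: affine_hull_min => [z Bz|z1 z2 z3 t h1 h2 h3].
    by apply: sub_affine_hull; right; exists 0 => //; exists z.
  suff -> : row_mx 0 (z1 + t *: (z2 - z3)) = row_mx 0 z1 +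
      t *: (row_mx 0 z2 - row_mx (0 : 'rV_m) z3) by exact: affine_hull_closed.
  by rewrite opp_row_mx add_row_mx scale_row_mx add_row_mx subrr scaler0 addr0.
(* The last row is the direction from the base point of [A] to that of [B]. *)
apply/has_dimP; exists (row_mx x 0),
  (col_mx (block_mx M 0 0 N) (row_mx (- x) y)); split.
  apply: inj_row_free => v; rewrite -(hsubmxK v) -(hsubmxK (lsubmx v)).
  move: (rsubmx v) (lsubmx (lsubmx v)) (rsubmx (lsubmx v)) => t a b.
  rewrite mul_row_col mul_row_block !mulmx0 addr0 add0r mul_mx_row add_row_mx.
  rewrite -[0 in RHS]row_mx0 => /eq_row_mx[e1 e2].
  have t0 : t = 0.
    apply/rowP => i; rewrite ord1 mxE; move/(congr1 (evaluation c)): e1.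
    rewrite evaluationD cM evaluation_at0 mulmxN evaluationN add0r.
    rewrite [t]mx11_scalar mul_scalar_mx evaluationZ affc// mxE mulr1n mulr1.
    by move/eqP; rewrite oppr_eq0 => /eqP.
  move: e1 e2; rewrite t0 !mul0mx !addr0 => e1 e2.
  have -> : a = 0 by apply: (row_free_inj freeM); rewrite e1 mul0mx.
  have -> : b = 0 by apply: (row_free_inj freeN); rewrite e2 mul0mx.
  by rewrite !row_mx0.
move=> z; rewrite affine_hull_convex_hull -/S; split.
  move: z; apply: affine_hull_min; last exact: coset_closed.
  move=> _ [[a Aa [_ -> <-]]|[_ -> [b Bb <-]]] /=; rewrite opp_row_mx add_row_mx.
    rewrite -addsmxE; apply: submx_trans (addsmxSl _ _).
    by rewrite sub_block_diag_mx subrr sub0mx andbT; apply/AM/sub_affine_hull.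
  rewrite -addsmxE.
  have -> : row_mx (0 - x) (b - 0) = row_mx 0 (b - y) + row_mx (- x) y.
    by rewrite add_row_mx subrK !add0r subr0.
  apply: addmx_sub_adds => //.
  by rewrite sub_block_diag_mx sub0mx /=; apply/BN/sub_affine_hull.
move=> /submxP[v]; rewrite -(hsubmxK v) -(hsubmxK (lsubmx v)).
move: (rsubmx v) (lsubmx (lsubmx v)) (rsubmx (lsubmx v)) => t a b.
rewrite mul_row_col mul_row_block !mulmx0 addr0 add0r.
rewrite [t]mx11_scalar mul_scalar_mx => e.
(* The point is reached from the copy of [A] by a move parallel to [B], followed by one in the
   joining direction. *)
have -> : z = (row_mx (x + a *m M) 0 + 1 *: (row_mx 0 (y + b *m N) - row_mx 0 y)) +
    t 0 0 *: (row_mx 0 y - row_mx x 0).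
  rewrite -[z](subrK (row_mx x 0)) e !opp_row_mx !add_row_mx !scale_row_mx.
  rewrite !add_row_mx !subr0 !sub0r !scale1r ?oppr0 !addr0 !add0r.
  by congr row_mx; [rewrite addrAC [a *m M + x]addrC|rewrite [y + _]addrC addrK].
have yB : affine_hull B y by apply/BN; rewrite subrr sub0mx.
apply: affine_hull_closed; [|exact: SB|exact: SA].
apply: affine_hull_closed; last exact: SB.
- by apply: SA; apply/AM; rewrite addrC addKr submxMl.
- by apply: SB; apply/BN; rewrite addrC addKr submxMl.
Qed.

(** * Products and sums *)

Lemma card_le_fset_set (I : finType) (T : choiceType) (g : I -> T) (S : set T) :
  finite_set S -> injective g -> (forall i, S (g i)) ->
  (#|I| <= #|` fset_set S|)%N.
Proof.
move=> fS ginj gS; rewrite cardT -(size_map g).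
apply: uniq_leq_size; first by rewrite map_inj_uniq// enum_uniq.
by move=> _ /mapP[i _ ->]; rewrite in_fset_set// inE.
Qed.

Lemma card_fset_set_le (I : finType) (T : choiceType) (g : I -> T) (S : set T) :
  (forall x, S x -> exists i, x = g i) -> (#|` fset_set S| <= #|I|)%N.
Proof.
move=> gS; rewrite cardT -(size_map g); apply: uniq_leq_size => // x.
have fS : finite_set S.
  apply: (@sub_finite_set _ _ [set` map g (enum I)]); last exact: finite_seq.
  by move=> y /gS[i ->]; rewrite /= map_f// mem_enum.
by rewrite in_fset_set// inE => /gS[i ->]; rewrite map_f// mem_enum.
Qed.

(** For infinite [S] the finite set [fset_set S] is empty, so there is no such [a]. *)
Lemma fset_set_val (T : choiceType) (S : set T) (a : fset_set S) : S (val a).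
Proof.
have : val a \in fset_set S by exact: valP.
move: (val a) => x; case: (pselect (finite_set S)) => [fS|nfS].
  by rewrite in_fset_set// inE.
by rewrite /fset_set; case: pselect.
Qed.

(** Finiteness of [S] is essential, since an infinite [S] would be counted as 0. *)
Lemma card_fset_set_mul (T1 T2 T : choiceType) (S1 : set T1) (S2 : set T2)
    (S : set T) (g : T1 -> T2 -> T) :
  finite_set S -> (forall a b, S1 a -> S2 b -> S (g a b)) ->
  (forall a b a' b', S1 a -> S2 b -> S1 a' -> S2 b' -> g a b = g a' b' ->
    a = a' /\ b = b') ->
  (#|` fset_set S1| * #|` fset_set S2| <= #|` fset_set S|)%N.
Proof.
move=> fS gS ginj; rewrite (cardfE (fset_set S1)) (cardfE (fset_set S2)) -card_prod.
apply: (card_le_fset_set (g := fun p : fset_set S1 * fset_set S2 =>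
  g (val p.1) (val p.2))) => //; last by move=> p; apply: gS; exact: fset_set_val.
move=> [a b] [a' b'] /= /ginj[]; try exact: fset_set_val.
by move=> /val_inj -> /val_inj ->.
Qed.

Lemma card_fset_set_add (T1 T2 T : choiceType) (S1 : set T1) (S2 : set T2)
    (S : set T) (g : T1 -> T) (h : T2 -> T) :
  finite_set S -> (forall a, S1 a -> S (g a)) -> (forall b, S2 b -> S (h b)) ->
  {in S1 &, injective g} -> {in S2 &, injective h} ->
  (forall a b, S1 a -> S2 b -> g a <> h b) ->
  (#|` fset_set S1| + #|` fset_set S2| <= #|` fset_set S|)%N.
Proof.
move=> fS gS hS ginj hinj gh; rewrite (cardfE (fset_set S1)) (cardfE (fset_set S2)) -card_sum.
apply: (card_le_fset_set (g := fun p : fset_set S1 + fset_set S2 =>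
  match p with inl a => g (val a) | inr b => h (val b) end)) => //.
- move=> [a|b] [a'|b'].
  + move/ginj => e; congr inl; apply/val_inj/e; rewrite inE; exact: fset_set_val.
  + by move=> e; case: (gh _ _ (fset_set_val a) (fset_set_val b')).
  + by move=> e; case: (gh _ _ (fset_set_val a') (fset_set_val b)).
  + move/hinj => e; congr inr; apply/val_inj/e; rewrite inE; exact: fset_set_val.
- by move=> [a|b]; [apply: gS|apply: hS]; exact: fset_set_val.
Qed.

(** * Convexity and symmetry of direct products and direct sums *)

Lemma direct_productE (R : realType) (m n : nat) (A : set 'rV[R]_m)
    (B : set 'rV[R]_n) x y :
  direct_product A B (row_mx x y) <-> A x /\ B y.
Proof.
split=> [[a Aa [b Bb /eq_row_mx[<- <-]]]|[Ax By]]//.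
by exists x => //; exists y.
Qed.

Lemma direct_product_inj (R : realType) (m n : nat) (A A' : set 'rV[R]_m)
    (B B' : set 'rV[R]_n) :
  (exists x, A x) -> (exists y, B y) ->
  direct_product A B = direct_product A' B' -> A = A' /\ B = B'.
Proof.
move=> [x Ax] [y By] e.
have H a b : A a /\ B b <-> A' a /\ B' b by rewrite -!direct_productE e.
have [A'x B'y] := (H x y).1 (conj Ax By).
split; apply/seteqP; split => z Az.
- by case: (H z y) => -[].
- by case: (H z y) => _ [].
- by case: (H x z) => -[].
- by case: (H x z) => _ [].
Qed.

Lemma direct_product_convex (R : realType) (m n : nat) (A : set 'rV[R]_m)
    (B : set 'rV[R]_n) :
  convex A -> convex B -> convex (direct_product A B).
Proof.
move=> Ac Bc x y s t s0 t0 st.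
rewrite -(hsubmxK x) -(hsubmxK y) => /direct_productE[? ?] /direct_productE[? ?].
rewrite !scale_row_mx add_row_mx; apply/direct_productE.
by split; [exact: Ac|exact: Bc].
Qed.

Lemma set1_convex (R : realType) (n : nat) (v : 'rV[R]_n) : convex [set v].
Proof. by move=> x y s t _ _ st -> ->; rewrite /= -scalerDl st scale1r. Qed.

Lemma convex_slice_l (R : realType) (m n : nat) (S : set 'rV[R]_(m + n)) y :
  convex S -> convex [set x | S (row_mx x y)].
Proof.
move=> Sc a b s t s0 t0 st /= Sa Sb.
have -> : row_mx (s *: a + t *: b) y = s *: row_mx a y + t *: row_mx b y.
  by rewrite !scale_row_mx add_row_mx -scalerDl st scale1r.
exact: Sc.
Qed.

Lemma convex_slice_r (R : realType) (m n : nat) (S : set 'rV[R]_(m + n)) x :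
  convex S -> convex [set y | S (row_mx x y)].
Proof.
move=> Sc a b s t s0 t0 st /= Sa Sb.
have -> : row_mx x (s *: a + t *: b) = s *: row_mx x a + t *: row_mx x b.
  by rewrite !scale_row_mx add_row_mx -scalerDl st scale1r.
exact: Sc.
Qed.

(** Fixing one component of a convex set leaves a convex set, so the hull can be filled one factor
    at a time. *)
Lemma convex_hull_product (R : realType) (m n : nat) (A : set 'rV[R]_m)
    (B : set 'rV[R]_n) :
  convex_hull (direct_product A B) = direct_product (convex_hull A) (convex_hull B).
Proof.
apply/seteqP; split.
  apply: convex_hull_min.
    by move=> _ [x Ax [y By <-]]; apply/direct_productE; split; exact: sub_convex_hull.
  by apply: direct_product_convex; exact: convex_hull_convex.
move=> _ [x Ax [y By <-]]; move: x Ax.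
apply: convex_hull_min; last exact: convex_slice_l (@convex_hull_convex _ _ _).
move=> a Aa /=; move: y By.
apply: convex_hull_min; last exact: convex_slice_r (@convex_hull_convex _ _ _).
by move=> b Bb /=; apply: sub_convex_hull; apply/direct_productE.
Qed.

Lemma polytope_product (R : realType) (m n : nat) (P : set 'rV[R]_m)
    (Q : set 'rV[R]_n) :
  polytope P -> polytope Q -> polytope (direct_product P Q).
Proof.
move=> [A fA ->] [B fB ->]; exists (direct_product A B).
  exact: finite_image2.
by rewrite convex_hull_product.
Qed.

Lemma polytope_sum (R : realType) (m n : nat) (P : set 'rV[R]_m)
    (Q : set 'rV[R]_n) :
  polytope P -> polytope Q -> polytope (direct_sum P Q).
Proof.
move=> [A fA ->] [B fB ->].
exists (direct_product A [set 0] `|` direct_product [set 0] B).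
  by rewrite finite_setU; split; apply: finite_image2.
have c0 k : [set 0] = convex_hull [set (0 : 'rV[R]_k)].
  by rewrite convex_hull_id//; exact: set1_convex.
rewrite /direct_sum [in LHS](c0 m) [in LHS](c0 n) -!convex_hull_product.
apply/seteqP; split.
  apply: convex_hull_min; last exact: convex_hull_convex.
  by rewrite subUset; split; apply: convex_hull_mono => z; [left|right].
by apply: convex_hull_mono => z [] ?; [left|right]; exact: sub_convex_hull.
Qed.

Lemma centrally_symmetricP (R : realType) (n : nat) (P : set 'rV[R]_n) :
  centrally_symmetric P <-> forall x, P x -> P (- x).
Proof.
rewrite /centrally_symmetric; split=> [e x Px|H]; first by rewrite e; exists x.
apply/seteqP; split=> [x Px|_ [x Px <-]]; last exact: H.
by exists (- x); [exact: H|rewrite opprK].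
Qed.

Lemma centrally_symmetric_product (R : realType) (m n : nat) (P : set 'rV[R]_m)
    (Q : set 'rV[R]_n) :
  centrally_symmetric P -> centrally_symmetric Q ->
  centrally_symmetric (direct_product P Q).
Proof.
move=> /centrally_symmetricP sP /centrally_symmetricP sQ.
apply/centrally_symmetricP => _ [x Px [y Qy <-]].
by rewrite opp_row_mx; apply/direct_productE; split; [exact: sP|exact: sQ].
Qed.

Lemma centrally_symmetric_sum (R : realType) (m n : nat) (P : set 'rV[R]_m)
    (Q : set 'rV[R]_n) :
  centrally_symmetric P -> centrally_symmetric Q ->
  centrally_symmetric (direct_sum P Q).
Proof.
move=> /centrally_symmetricP sP /centrally_symmetricP sQ.
apply/centrally_symmetricP; apply: convex_hull_min.
  move=> _ [] [x Px [y Qy <-]] /=; apply: sub_convex_hull; [left|right];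
    rewrite opp_row_mx; apply/direct_productE.
    by split; [exact: sP|rewrite Qy oppr0].
  by split; [rewrite Px oppr0|exact: sQ].
move=> x y s t s0 t0 st /= hx hy; rewrite opprD -!scalerN.
exact: convex_hull_convex.
Qed.

Lemma centrally_symmetric0 (R : realType) (n : nat) (P : set 'rV[R]_n) x :
  convex P -> centrally_symmetric P -> P x -> P 0.
Proof.
move=> Pc /centrally_symmetricP sP Px.
have -> : 0 = 2^-1 *: x + 2^-1 *: - x by rewrite scalerN subrr.
by apply: Pc; rewrite ?invr_ge0//; [lra|exact: sP].
Qed.

(** * Faces of direct products and direct sums *)

Lemma face_product (R : realType) (m n : nat) (P F : set 'rV[R]_m)
    (Q G : set 'rV[R]_n) :
  face P F -> face Q G -> face (direct_product P Q) (direct_product F G).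
Proof.
move=> [c [b [cb ->]]] [e [a [ea ->]]].
exists (col_mx c e), (b + a); split.
  move=> _ [x Px [y Qy <-]]; rewrite -/(evaluation _ _) evaluation_col_mx.
  by apply: lerD; [exact: cb|exact: ea].
apply/seteqP; split.
  move=> _ [x [Px xb] [y [Qy ya] <-]]; split; first exact/direct_productE.
  by rewrite -/(evaluation _ _) evaluation_col_mx; congr (_ + _).
move=> _ [[x Px [y Qy <-]]]; rewrite -/(evaluation _ _) evaluation_col_mx.
have := cb _ Px; have := ea _ Qy; rewrite -!/(evaluation _ _) => h1 h2 h3.
by apply/direct_productE; split; split => //; rewrite -/(evaluation _ _); lra.
Qed.

(* Central symmetry puts the origin strictly below every proper face, so the
   supporting functional can be normalised to have value 1. *)
Lemma proper_face_level (R : realType) (n : nat) (P F : set 'rV[R]_n) :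
  centrally_symmetric P -> face P F -> (exists x, F x) -> F <> P ->
  exists c, (forall x, P x -> evaluation c x <= 1) /\
    F = [set x | P x /\ evaluation c x = 1].
Proof.
move=> /centrally_symmetricP sP [c [b [cb ->]]] [x [Px xb]] FP.
have {}cb y : P y -> evaluation c y <= b by exact: cb.
have cN y : P y -> - evaluation c y <= b.
  by move=> Py; rewrite -evaluationN; apply: cb; exact: sP.
have b0 : 0 <= b.
  by have := cN _ Px; rewrite /evaluation xb; lra.
have [b_eq0|b_neq0] := eqVneq b 0.
  exfalso; apply: FP; apply/seteqP; split => [y []//|y Py]; split => //.
  by have := cb _ Py; have := cN _ Py; rewrite b_eq0 /evaluation; lra.
have b_gt0 : 0 < b by rewrite lt_neqAle eq_sym b_neq0.
exists (b^-1 *: c); split=> [y Py|].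
  by rewrite evaluation_scale mulrC ler_pdivrMr// mul1r cb.
apply/seteqP; split => y [Py e]; split => //.
  by rewrite evaluation_scale /evaluation e mulVf.
move: e; rewrite evaluation_scale => /(congr1 ( *%R b)).
by rewrite mulrA divff// mul1r mulr1.
Qed.

(** The functional [col_mx c 0] is 0 on the copy of [Q], so level 1 meets only generators from
    [P]. *)
Lemma face_sum_l (R : realType) (m n : nat) (P : set 'rV[R]_m)
    (Q : set 'rV[R]_n) (c : 'cV[R]_m) :
  convex P -> (forall x, P x -> evaluation c x <= 1) ->
  face (direct_sum P Q)
    (direct_product [set x | P x /\ evaluation c x = 1] [set 0]).
Proof.
move=> Pc c1.
have le1 z : (direct_product P [set 0] `|` direct_product [set 0] Q) z ->
    evaluation (col_mx c 0) z <= 1.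
  move=> [[x Px [_ -> <-]]|[_ -> [y Qy <-]]]; rewrite evaluation_col_mx.
    by rewrite evaluation_at0 addr0; exact: c1.
  by rewrite evaluation_at0 /evaluation mulmx0 mxE addr0.
exists (col_mx c 0), 1; split; first exact: evaluation_convex_hull_le le1.
rewrite -[RHS]/[set z | convex_hull _ z /\ evaluation _ z = 1] face_convex_hull//.
rewrite [X in convex_hull X](_ : _ =
  direct_product [set x | P x /\ evaluation c x = 1] [set 0]).
  rewrite convex_hull_id//; apply: direct_product_convex; last exact: set1_convex.
  exact: convex_level.
apply/seteqP; split.
  move=> _ [[[x Px [_ -> <-]]|[_ -> [y Qy <-]]]]; rewrite evaluation_col_mx.
    by rewrite evaluation_at0 addr0 => xc; apply/direct_productE.
  rewrite evaluation_at0 /evaluation mulmx0 mxE addr0 => /esym/eqP.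
  by rewrite oner_eq0.
move=> _ [x [Px xc] [_ -> <-]]; split; first by left; apply/direct_productE.
by rewrite evaluation_col_mx evaluation_at0 addr0.
Qed.

Lemma face_sum_r (R : realType) (m n : nat) (P : set 'rV[R]_m)
    (Q : set 'rV[R]_n) (c : 'cV[R]_n) :
  convex Q -> (forall x, Q x -> evaluation c x <= 1) ->
  face (direct_sum P Q)
    (direct_product [set 0] [set x | Q x /\ evaluation c x = 1]).
Proof.
move=> Qc c1.
have le1 z : (direct_product P [set 0] `|` direct_product [set 0] Q) z ->
    evaluation (col_mx 0 c) z <= 1.
  move=> [[x Px [_ -> <-]]|[_ -> [y Qy <-]]]; rewrite evaluation_col_mx.
    by rewrite evaluation_at0 /evaluation mulmx0 mxE addr0.
  by rewrite evaluation_at0 add0r; exact: c1.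
exists (col_mx 0 c), 1; split; first exact: evaluation_convex_hull_le le1.
rewrite -[RHS]/[set z | convex_hull _ z /\ evaluation _ z = 1] face_convex_hull//.
rewrite [X in convex_hull X](_ : _ =
  direct_product [set 0] [set x | Q x /\ evaluation c x = 1]).
  rewrite convex_hull_id//; apply: direct_product_convex; first exact: set1_convex.
  exact: convex_level.
apply/seteqP; split.
  move=> _ [[[x Px [_ -> <-]]|[_ -> [y Qy <-]]]]; rewrite evaluation_col_mx.
    rewrite evaluation_at0 /evaluation mulmx0 mxE addr0 => /esym/eqP.
    by rewrite oner_eq0.
  by rewrite evaluation_at0 add0r => xc; apply/direct_productE.
move=> _ [_ -> [y [Qy yc] <-]]; split; first by right; apply/direct_productE.
by rewrite evaluation_col_mx evaluation_at0 add0r.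
Qed.

Definition join (R : realType) (m n : nat) (F : set 'rV[R]_m) (G : set 'rV[R]_n) :=
  convex_hull (direct_product F [set 0] `|` direct_product [set 0] G).

(** Both functionals are normalised to level 1, so [col_mx c e] reaches its bound on both copies at
    once. *)
Lemma face_sum_join (R : realType) (m n : nat) (P : set 'rV[R]_m)
    (Q : set 'rV[R]_n) (c : 'cV[R]_m) (e : 'cV[R]_n) :
  (forall x, P x -> evaluation c x <= 1) ->
  (forall y, Q y -> evaluation e y <= 1) ->
  face (direct_sum P Q) (join [set x | P x /\ evaluation c x = 1]
    [set y | Q y /\ evaluation e y = 1]).
Proof.
move=> c1 e1.
have le1 z : (direct_product P [set 0] `|` direct_product [set 0] Q) z ->
    evaluation (col_mx c e) z <= 1.
  move=> [[x Px [_ -> <-]]|[_ -> [y Qy <-]]]; rewrite evaluation_col_mx.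
    by rewrite evaluation_at0 addr0; exact: c1.
  by rewrite evaluation_at0 add0r; exact: e1.
exists (col_mx c e), 1; split; first exact: evaluation_convex_hull_le le1.
rewrite -[RHS]/[set z | convex_hull _ z /\ evaluation _ z = 1] face_convex_hull//.
congr convex_hull; apply/seteqP; split.
  move=> _ [[x [Px xc] [_ -> <-]]|[_ -> [y [Qy yc] <-]]]; split.
  - by left; apply/direct_productE.
  - by rewrite evaluation_col_mx evaluation_at0 addr0.
  - by right; apply/direct_productE.
  - by rewrite evaluation_col_mx evaluation_at0 add0r.
move=> _ [[[x Px [_ -> <-]]|[_ -> [y Qy <-]]]]; rewrite evaluation_col_mx.
  by rewrite evaluation_at0 addr0 => xc; left; apply/direct_productE.
by rewrite evaluation_at0 add0r => yc; right; apply/direct_productE.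
Qed.

(** Slicing recovers both faces from their join, which makes the join injective on pairs of faces.
    The join lies in the product at level 1 of [col_mx c e], and on a coordinate subspace this level
    is that of [c] or [e] alone. *)
Lemma join_sliceE (R : realType) (m n : nat) (P : set 'rV[R]_m)
    (Q : set 'rV[R]_n) (c : 'cV[R]_m) (e : 'cV[R]_n) :
  convex P -> convex Q -> P 0 -> Q 0 ->
  let F := [set x | P x /\ evaluation c x = 1] in
  let G := [set y | Q y /\ evaluation e y = 1] in
  [set x | join F G (row_mx x 0)] = F /\ [set y | join F G (row_mx 0 y)] = G.
Proof.
move=> Pc Qc P0 Q0 F G.
have sub z : join F G z -> (direct_product P Q) z /\ evaluation (col_mx c e) z = 1.
  move: z; apply: convex_hull_min; last first.
    by apply: convex_level; exact: direct_product_convex.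
  move=> _ [[x [Px xc] [_ -> <-]]|[_ -> [y [Qy yc] <-]]]; split.
  - by apply/direct_productE.
  - by rewrite evaluation_col_mx evaluation_at0 addr0.
  - by apply/direct_productE.
  - by rewrite evaluation_col_mx evaluation_at0 add0r.
split; apply/seteqP; split => z /=.
- move=> /sub[/direct_productE[Pz _]].
  by rewrite evaluation_col_mx evaluation_at0 addr0.
- by move=> Fz; apply: sub_convex_hull; left; apply/direct_productE.
- move=> /sub[/direct_productE[_ Qz]].
  by rewrite evaluation_col_mx evaluation_at0 add0r.
- by move=> Gz; apply: sub_convex_hull; right; apply/direct_productE.
Qed.

(** Sum and product have the same affine hull, because (x, y) = (x, 0) + (0, y) - (0, 0) and both
    summands contain the origin. *)
Lemma has_dim_sum (R : realType) (m n : nat) (P : set 'rV[R]_m)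
    (Q : set 'rV[R]_n) k l :
  P 0 -> Q 0 -> has_dim P k -> has_dim Q l -> has_dim (direct_sum P Q) (k + l).
Proof.
move=> P0 Q0 Pk Ql; have := has_dim_product Pk Ql; apply: eq_has_dim.
rewrite affine_hull_convex_hull; apply/seteqP; split; last first.
  apply: affine_hull_min; last exact: affine_hull_closed.
  move=> _ [[x Px [_ -> <-]]|[_ -> [y Qy <-]]]; apply: sub_affine_hull;
    exact/direct_productE.
apply: affine_hull_min; last exact: affine_hull_closed.
move=> _ [x Px [y Qy <-]].
have -> : row_mx x y = row_mx x 0 + 1 *: (row_mx 0 y - row_mx 0 0).
  by rewrite row_mx0 subr0 scale1r add_row_mx addr0 add0r.
apply: affine_hull_closed; apply: sub_affine_hull.
- by left; apply/direct_productE.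
- by right; apply/direct_productE.
- by right; apply/direct_productE.
Qed.

(** * Hanner polytopes *)

Lemma low_dim_face_level (R : realType) (n d k : nat) (P F : set 'rV[R]_n) :
  centrally_symmetric P -> has_dim P d -> face P F -> has_dim F k -> k <> d ->
  exists c, (forall x, P x -> evaluation c x <= 1) /\
    F = [set x | P x /\ evaluation c x = 1].
Proof.
move=> sP Pd fF Fk kd; apply: proper_face_level => //.
  exact: has_dim_nonempty Fk.
by move=> FP; apply: kd; apply: (has_dim_uniq (A := P)) => //; rewrite -FP.
Qed.

Lemma f_num_product_mul (R : realType) (m n k l : nat) (P : set 'rV[R]_m)
    (Q : set 'rV[R]_n) :
  polytope P -> polytope Q ->
  (f_num k P * f_num l Q <= f_num (k + l) (direct_product P Q))%N.
Proof.
move=> pP pQ; apply: (card_fset_set_mul (g := @direct_product R m n)).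
- exact/finite_faces_dim/polytope_product.
- move=> F G [fF Fk] [fG Gl]; split; first exact: face_product.
  exact: has_dim_product.
- move=> F G F' G' [_ /has_dim_nonempty F0] [_ /has_dim_nonempty G0] _ _.
  exact: direct_product_inj.
Qed.

Lemma f_num_product_facets (R : realType) (m n k l : nat) (P : set 'rV[R]_m)
    (Q : set 'rV[R]_n) :
  polytope P -> polytope Q -> has_dim P k.+1 -> has_dim Q l.+1 ->
  (f_num k P + f_num l Q <= f_num (k + l).+1 (direct_product P Q))%N.
Proof.
move=> pP pQ Pk Ql; have P0 := has_dim_nonempty Pk; have Q0 := has_dim_nonempty Ql.
apply: (card_fset_set_add (g := fun F => direct_product F Q)
  (h := fun G => direct_product P G)).
- exact/finite_faces_dim/polytope_product.
- move=> F [fF Fk]; split; first exact: face_product fF (face_refl Q).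
  by rewrite -addnS; exact: has_dim_product.
- move=> G [fG Gl]; split; first exact: face_product (face_refl P) fG.
  by rewrite -addSn; exact: has_dim_product.
- move=> F G; rewrite !inE => -[_ /has_dim_nonempty F0] _.
  by move=> /(direct_product_inj F0 Q0)[].
- move=> F G; rewrite !inE => -[_ /has_dim_nonempty F0] _.
  by move=> /(direct_product_inj P0 F0)[].
- move=> F G [_ Fk] _ /(direct_product_inj (has_dim_nonempty Fk) Q0)[FP _].
  by move: Fk; rewrite FP => /(has_dim_uniq Pk) e; lia.
Qed.

(** For [k = 0] this counts vertices. A face from [P] and one from [Q] could coincide only at the
    origin, which lies on no proper face of a centrally symmetric polytope. *)
Lemma f_num_sum_add (R : realType) (m n k d e : nat) (P : set 'rV[R]_m)
    (Q : set 'rV[R]_n) :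
  polytope P -> polytope Q -> centrally_symmetric P -> centrally_symmetric Q ->
  has_dim P d -> has_dim Q e -> (k < d)%N -> (k < e)%N ->
  (f_num k P + f_num k Q <= f_num k (direct_sum P Q))%N.
Proof.
move=> pP pQ sP sQ Pd Qe kd ke.
have kd' : k <> d by lia.
have ke' : k <> e by lia.
have N1 j : exists x, [set (0 : 'rV[R]_j)] x by exists 0.
apply: (card_fset_set_add (g := fun F => direct_product F [set 0])
  (h := fun G => direct_product [set 0] G)).
- exact/finite_faces_dim/polytope_sum.
- move=> F [fF Fk]; split.
    have [c [c1 ->]] := low_dim_face_level sP Pd fF Fk kd'.
    exact: face_sum_l (polytope_convex pP) c1.
  by rewrite -[k]addn0; apply: has_dim_product => //; exact: has_dim_set1.
- move=> G [fG Gk]; split.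
    have [c [c1 ->]] := low_dim_face_level sQ Qe fG Gk ke'.
    exact: face_sum_r (polytope_convex pQ) c1.
  by rewrite -[k]add0n; apply: has_dim_product => //; exact: has_dim_set1.
- move=> F G; rewrite !inE => -[_ /has_dim_nonempty F0] _.
  by move=> /(direct_product_inj F0 (N1 _))[].
- move=> F G; rewrite !inE => -[_ /has_dim_nonempty F0] _.
  by move=> /(direct_product_inj (N1 _) F0)[].
- move=> F G [fF Fk] _ /(direct_product_inj (has_dim_nonempty Fk) (N1 _))[F0 _].
  have [c [c1 Fc]] := low_dim_face_level sP Pd fF Fk kd'.
  have : F 0 by rewrite F0.
  by rewrite Fc => -[_]; rewrite evaluation_at0 => /esym/eqP; rewrite oner_eq0.
Qed.

(** Used for facets: the join of two facets has codimension 1 in the sum. *)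
Lemma f_num_sum_mul (R : realType) (m n k l d e : nat) (P : set 'rV[R]_m)
    (Q : set 'rV[R]_n) :
  polytope P -> polytope Q -> centrally_symmetric P -> centrally_symmetric Q ->
  has_dim P d -> has_dim Q e -> (k < d)%N -> (l < e)%N ->
  (f_num k P * f_num l Q <= f_num (k + l).+1 (direct_sum P Q))%N.
Proof.
move=> pP pQ sP sQ Pd Qe kd le.
have kd' : k <> d by lia.
have le' : l <> e by lia.
have Pc := polytope_convex pP; have Qc := polytope_convex pQ.
have [x Px] := has_dim_nonempty Pd; have [y Qy] := has_dim_nonempty Qe.
have P0 := centrally_symmetric0 Pc sP Px.
have Q0 := centrally_symmetric0 Qc sQ Qy.
apply: (card_fset_set_mul (g := @join R m n)).
- exact/finite_faces_dim/polytope_sum.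
- move=> F G [fF Fk] [fG Gl].
  have [c [c1 Fc]] := low_dim_face_level sP Pd fF Fk kd'.
  have [u [u1 Gu]] := low_dim_face_level sQ Qe fG Gl le'.
  split; first by rewrite Fc Gu; exact: face_sum_join.
  rewrite -addn1; apply: (has_dim_join (c := c)) => //.
  by rewrite Fc => z [].
- move=> F G F' G' [fF Fk] [fG Gl] [fF' F'k] [fG' G'l].
  have [c [c1 Fc]] := low_dim_face_level sP Pd fF Fk kd'.
  have [u [u1 Gu]] := low_dim_face_level sQ Qe fG Gl le'.
  have [c' [_ Fc']] := low_dim_face_level sP Pd fF' F'k kd'.
  have [u' [_ Gu']] := low_dim_face_level sQ Qe fG' G'l le'.
  have [] := join_sliceE c u Pc Qc P0 Q0; rewrite -Fc -Gu => eF eG.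
  have [] := join_sliceE c' u' Pc Qc P0 Q0; rewrite -Fc' -Gu' => eF' eG' e'.
  by split; [rewrite -eF -eF' e'|rewrite -eG -eG' e'].
Qed.

Lemma finite_set_max (R : realType) (T : choiceType) (A : set T) (f : T -> R) x :
  finite_set A -> A x -> exists2 a, A a & forall y, A y -> f y <= f a.
Proof.
move=> fA Ax; have xA : x \in fset_set A by rewrite in_fset_set// inE.
case: (@arg_maxP _ R _ [` xA]%fset xpredT (fun i => f (val i))) => // a _ amax.
exists (val a); first exact: fset_set_val.
move=> y Ay; have yA : y \in fset_set A by rewrite in_fset_set// inE.
exact: (amax [` yA]%fset).
Qed.

Lemma segment_vertices (R : realType) (n : nat) (P : set 'rV[R]_n) :
  dpolytope 1 P -> centrally_symmetric P -> (2 <= f_num 0 P)%N.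
Proof.
move=> [pP P1] sP; have /centrally_symmetricP sP' := sP.
have [x Px] := has_dim_nonempty P1.
have P0 := centrally_symmetric0 (polytope_convex pP) sP Px.
have /has_dimP[z [M [freeM PM]]] := P1.
have zM : (0 - z <= M)%MS by apply/PM/sub_affine_hull.
have line y : P y -> exists t, y = t *: M.
  move=> /sub_affine_hull/PM; rewrite -(submx_shift _ zM) subr0 => /submxP[D ->].
  by exists (D 0 0); rewrite [D in LHS]mx11_scalar mul_scalar_mx.
(* [M] spans the line of [P]. Pairing with [M] itself gives a coordinate on that line, as its value
   [q] at [M] is a sum of squares. *)
pose c := M^T; pose q := evaluation c M.
have q_neq0 : q != 0.
  apply/negP => /eqP q0; suff M0 : M = 0.
    by move: freeM; rewrite /row_free M0 mxrank0.
  apply/rowP => i; rewrite mxE; apply/eqP; rewrite -sqrf_eq0; apply/eqP.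
  move: q0; rewrite /q /evaluation mxE => /psumr_eq0P H.
  by rewrite expr2 -[RHS](H _ i)// ?mxE// => j _; rewrite mxE -expr2 sqr_ge0.
have inj y y' : P y -> P y' -> evaluation c y = evaluation c y' -> y = y'.
  move=> /line[t ->] /line[t' ->]; rewrite !evaluationZ => /mulIf ->//.
have [a Pa amax] : exists2 a, P a & forall y, P y -> evaluation c y <= evaluation c a.
  case: pP P0 => A fA -> [[|m]] [p [w [Ap _ w1 _]]].
    by move: w1; rewrite big_ord0 => /esym/eqP; rewrite oner_eq0.
  have [a Aa amax] := finite_set_max (evaluation c) fA (Ap ord0).
  exists a; first exact: sub_convex_hull.
  exact: evaluation_convex_hull_le.
(* Otherwise the maximum of [c] on [P] is 0, and by symmetry [P] would be the single point 0. *)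
have a_neq : a <> - a.
  move=> aN; have ca : evaluation c a = 0.
    by move: (congr1 (evaluation c) aN); rewrite evaluationN; lra.
  suff PE : P = [set 0] by have := has_dim_set1 (0 : 'rV[R]_n); rewrite -PE => /(has_dim_uniq P1).
  apply/seteqP; split => [y Py|y ->//]; apply: inj => //; rewrite evaluation_at0.
  by have := amax _ Py; have := amax _ (sP' _ Py); rewrite evaluationN ca; lra.
have fa : face P [set a].
  exists c, (evaluation c a); split; first exact: amax.
  apply/seteqP; split => [y ->//|y [Py e]]; exact: inj.
have fN : face P [set - a].
  have ev y : evaluation (- c) y = evaluation c (- y).
    by rewrite /evaluation mulmxN mulNmx.
  exists (- c), (evaluation c a).
  split=> [y Py|]; first by rewrite -/(evaluation _ _) ev; apply/amax/sP'.
  apply/seteqP; split => [y ->|y [Py]] /=; rewrite -/(evaluation _ _) ev.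
    by rewrite opprK; split => //; exact: sP'.
  by move=> e; rewrite -[y]opprK; congr (- _); apply: inj => //; exact: sP'.
rewrite -card_bool; apply: (card_le_fset_set (g := fun b : bool =>
  if b then [set a] else [set - a])).
- exact: finite_faces_dim.
- have ne : [set a] <> [set - a] by move/seteqP => -[/(_ a)] /(_ erefl).
  by move=> [] [] //= e; exfalso; apply: ne.
- by case; split => //; exact: has_dim_set1.
Qed.

(* V and F are the numbers of vertices and facets. The last clause is the one
   needed in the end; the others make the induction go through. *)
Definition hanner_bound (d V F : nat) :=
  [/\ (2 * d <= V)%N, (2 * d <= F)%N, (F <= 2 * d + 1 -> 2 ^ d <= V)%N
    & (F <= 2 * d + 2 -> 3 * 2 ^ d <= 4 * V)%N].

(** The excess [F - 2 * d] is at least the sum of the excesses of the factors. An excess of at most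
    2 therefore leaves both factors with at most 1, or gives 2 to one of them and 0 to the other, so
    that the factor 3/4 is lost at most once. *)
Lemma hanner_bound_product d1 V1 F1 d2 V2 F2 V F :
  (0 < d1)%N -> (0 < d2)%N -> hanner_bound d1 V1 F1 -> hanner_bound d2 V2 F2 ->
  (V1 * V2 <= V)%N -> (F1 + F2 <= F)%N -> hanner_bound (d1 + d2) V F.
Proof.
move=> d1_gt0 d2_gt0 [a1 b1 c1 e1] [a2 b2 c2 e2] hV hF; rewrite /hanner_bound expnD.
(* This is [(d1 - 1) * (d2 - 1) >= 0]; it turns [V1 * V2 >= 4 * d1 * d2] into the linear bound on
   [V]. *)
have hd : (d1 + d2 <= d1 * d2 + 1)%N by nia.
split; [have := leq_mul a1 a2; lia|lia| |] => h.
- apply: leq_trans hV; apply: leq_mul; [apply: c1|apply: c2]; lia.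
- have [h1|h1] := leqP F1 (2 * d1 + 1); have [h2|h2] := leqP F2 (2 * d2 + 1).
  + have := leq_mul (c1 h1) (c2 h2); lia.
  + have := leq_mul (c1 h1) (e2 ltac:(lia)); nia.
  + have := leq_mul (e1 ltac:(lia)) (c2 h2); nia.
  + lia.
Qed.

(** Since [F >= 4 * d1 * d2], few facets leave only the dimension pairs (1, 1), (1, 2) and (2, 1).
    The last two are the origin of 3/4: they give at least 2 + 4 = 6 vertices, against 8 for the
    3-cube. *)
Lemma hanner_bound_sum d1 V1 F1 d2 V2 F2 V F :
  (0 < d1)%N -> (0 < d2)%N -> hanner_bound d1 V1 F1 -> hanner_bound d2 V2 F2 ->
  (V1 + V2 <= V)%N -> (F1 * F2 <= F)%N -> hanner_bound (d1 + d2) V F.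
Proof.
move=> d1_gt0 d2_gt0 [a1 b1 c1 e1] [a2 b2 c2 e2] hV hF.
have hdF : (4 * (d1 * d2) <= F)%N.
  by apply: leq_trans hF; have := leq_mul b1 b2; nia.
have hd : (d1 + d2 <= d1 * d2 + 1)%N by nia.
split; [lia|lia| |] => h.
- have [-> ->] : d1 = 1%N /\ d2 = 1%N by lia.
  by rewrite -[(2 ^ _)%N]/4%N; lia.
- have [[e e']|[[e e']|[e e']]] : (d1 = 1 /\ d2 = 1 \/ d1 = 1 /\ d2 = 2 \/
      d1 = 2 /\ d2 = 1)%N by lia.
  + by subst; rewrite -[(2 ^ _)%N]/4%N; lia.
  + by subst; rewrite -[(2 ^ _)%N]/8%N; lia.
  + by subst; rewrite -[(2 ^ _)%N]/8%N; lia.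
Qed.

(** Writing the dimension as [d.+1] makes [d] the dimension of a facet. *)
Lemma hanner_face_bound (R : realType) (n : nat) (H : set 'rV[R]_n) :
  hanner H -> exists d, [/\ polytope H, centrally_symmetric H, has_dim H d.+1
    & hanner_bound d.+1 (f_num 0 H) (f_num d H)].
Proof.
elim=> {n H} [n P [pP P1] sP|m n P Q _ [d [pP sP Pd bP]] _ [e [pQ sQ Qe bQ]]
  |m n P Q _ [d [pP sP Pd bP]] _ [e [pQ sQ Qe bQ]]].
(* For a segment, vertices and facets are the same faces. *)
- exists 0%N; have := segment_vertices (conj pP P1) sP.
  by split => //; split => //; lia.
- exists (d + e).+1; split.
  + exact: polytope_sum.
  + exact: centrally_symmetric_sum.
  + rewrite -addSn -addnS; apply: has_dim_sum => //.
      have [x Px] := has_dim_nonempty Pd.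
      exact: centrally_symmetric0 (polytope_convex pP) sP Px.
    have [x Qx] := has_dim_nonempty Qe.
    exact: centrally_symmetric0 (polytope_convex pQ) sQ Qx.
  + rewrite -{1}addSn -{1}addnS; apply: hanner_bound_sum bP bQ _ _ => //.
      exact: f_num_sum_add Pd Qe _ _.
    exact: f_num_sum_mul Pd Qe _ _.
- exists (d + e).+1; split.
  + exact: polytope_product.
  + exact: centrally_symmetric_product.
  + by rewrite -addSn -addnS; exact: has_dim_product.
  + rewrite -{1}addSn -{1}addnS; apply: hanner_bound_product bP bQ _ _ => //.
      exact: f_num_product_mul.
    exact: f_num_product_facets.
Qed.

(** * The sliced cube *)

Lemma has_dim_rank (R : realType) (n m : nat) (A : set 'rV[R]_n) x
    (N : 'M[R]_(m, n)) :
  (forall y, affine_hull A y <-> (y - x <= N)%MS) -> has_dim A (\rank N).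
Proof.
move=> AN; apply/has_dimP; exists x, (row_base N); split; first exact: row_base_free.
by move=> y; rewrite eq_row_base.
Qed.

Lemma evaluation_eq0 (R : realType) (n : nat) (c : 'cV[R]_n) x :
  evaluation c x = 0 <-> (x <= kermx c)%MS.
Proof.
split=> [x0|/sub_kermxP x0]; last by rewrite /evaluation x0 mxE.
apply/sub_kermxP; rewrite [x *m c]mx11_scalar -/(evaluation _ _) x0.
by rewrite raddf0.
Qed.

Lemma evaluation_delta (R : realType) (n : nat) (j : 'I_n) (x : 'rV[R]_n) :
  evaluation (delta_mx j 0) x = x 0 j.
Proof. by rewrite /evaluation -colE mxE. Qed.

Definition six_sum (R : realType) (m : nat) : 'cV[R]_(6 + m) :=
  col_mx (const_mx 1) 0.

Lemma six_sumE (R : realType) (m : nat) (x : 'rV[R]_(6 + m)) :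
  evaluation (six_sum R m) x = \sum_(j < 6) x 0 (lshift m j).
Proof.
rewrite -{1}[x]hsubmxK evaluation_col_mx /evaluation mulmx0 [X in _ + X]mxE addr0.
by rewrite mxE; apply: eq_bigr => j _; rewrite !mxE mulr1.
Qed.

(* Up to scaling and translation, the product of the hypersimplex Delta(3, 6)
   and an m-cube. *)
Definition sliced_cube (R : realType) (m : nat) : set 'rV[R]_(6 + m) :=
  [set x : 'rV[R]_(6 + m) | (forall j, -1 <= x 0 j <= 1) /\ evaluation (six_sum R m) x = 0].

Lemma sliced_cube_convex (R : realType) (m : nat) : convex (@sliced_cube R m).
Proof.
apply: convex_level => x y s t s0 t0 st xb yb j; rewrite !mxE.
by move: (xb j) (yb j) => /andP[? ?] /andP[? ?]; nra.
Qed.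

Lemma sliced_cube_symmetric (R : realType) (m : nat) :
  centrally_symmetric (@sliced_cube R m).
Proof.
apply/centrally_symmetricP => x [xb xs]; split.
  by move=> j; rewrite mxE; move: (xb j); lra.
by rewrite evaluationN xs oppr0.
Qed.

Lemma sliced_cube0 (R : realType) (m : nat) : @sliced_cube R m 0.
Proof. by split; [move=> j; rewrite mxE; lra|rewrite evaluation_at0]. Qed.

Definition free_coords (R : realType) (m : nat) (x : 'rV[R]_(6 + m)) :=
  [set j | (x 0 j != 1) && (x 0 j != -1)]%SET.

(** The point moves along [u] until a free coordinate first hits 1 or -1; the coordinates already
    there stay put. *)
Lemma sliced_cube_move (R : realType) (m : nat) (x u : 'rV[R]_(6 + m)) :
  sliced_cube x -> evaluation (six_sum R m) u = 0 -> u != 0 ->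
  (forall j, u 0 j != 0 -> j \in free_coords x) ->
  exists a, [/\ 0 < a, sliced_cube (x + a *: u) &
    (#|free_coords (x + a *: u)| < #|free_coords x|)%N].
Proof.
move=> [xb xs] us u_neq0 uf.
have xlt j : u 0 j != 0 -> -1 < x 0 j < 1.
  move=> /uf; rewrite inE => /andP[h1 h2]; rewrite !lt_neqAle h1 eq_sym h2 /=.
  exact: xb.
have [j0 uj0] : exists j, u 0 j != 0.
  apply/existsP; apply: contraNT u_neq0; rewrite negb_exists => /forallP u0.
  by apply/eqP/rowP => j; rewrite mxE; apply/eqP; move: (u0 j); rewrite negbK.
(* [r j] is the time at which coordinate [j] reaches the bound that it moves towards. *)
pose r j := if 0 < u 0 j then (1 - x 0 j) / u 0 j else (1 + x 0 j) / - u 0 j.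
have rgt0 j : u 0 j != 0 -> 0 < r j.
  move=> uj; have /andP[h1 h2] := xlt j uj; rewrite /r; case: (ltP 0 (u 0 j)) => uj0'.
    by apply: divr_gt0 => //; lra.
  have uj1 : u 0 j < 0 by rewrite lt_neqAle uj.
  by apply: divr_gt0; lra.
case: (@arg_minP _ R _ j0 (fun j => u 0 j != 0) r uj0) => k uk kmin.
exists (r k); split; first exact: rgt0.
- split; last by rewrite evaluationD evaluationZ xs us mulr0 addr0.
  move=> j; rewrite !mxE; have [->|uj] := eqVneq (u 0 j) 0.
    by rewrite mulr0 addr0.
  have /andP[h1 h2] := xlt j uj; have := kmin j uj; have := rgt0 k uk.
  move: (r k) => a a0; rewrite /r; case: (ltP 0 (u 0 j)) => uj0' h.
    move: h; rewrite ler_pdivlMr// => h; have : 0 <= a * u 0 j by nra.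
    by lra.
  have uj1 : u 0 j < 0 by rewrite lt_neqAle uj.
  move: h; rewrite ler_pdivlMr ?oppr_gt0// => h; have : a * u 0 j <= 0 by nra.
  by move: h; rewrite mulrN; lra.
- apply: proper_card; apply/properP; split.
    apply/fintype.subsetP => j; have [uj|uj] := eqVneq (u 0 j) 0.
      by rewrite !inE !mxE uj mulr0 addr0.
    by move=> _; exact: uf.
  exists k; first exact: uf.
  rewrite !inE !mxE /r; case: (ltP 0 (u 0 k)) => uk0.
    have -> : x 0 k + (1 - x 0 k) / u 0 k * u 0 k = 1 by field.
    by rewrite eqxx.
  have -> : x 0 k + (1 + x 0 k) / - u 0 k * u 0 k = -1 by field.
  by rewrite eqxx andbF.
Qed.

Lemma convex_between (R : realType) (n : nat) (S : set 'rV[R]_n) x u (a b : R) :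
  convex S -> 0 < a -> 0 < b -> S (x + a *: u) -> S (x - b *: u) -> S x.
Proof.
move=> Sc a0 b0 Sy Sz; have ab : a + b != 0 by rewrite gt_eqF// addr_gt0.
have := Sc _ _ (b / (a + b)) (a / (a + b)) _ _ _ Sy Sz.
rewrite !scalerDr scalerN !scalerA addrACA -scalerDl.
have -> : b / (a + b) + a / (a + b) = 1 by rewrite -mulrDl [b + a]addrC divff.
have -> : b / (a + b) * a = a / (a + b) * b by ring.
rewrite subrr addr0 scale1r; apply => //.
all: by rewrite divr_ge0 ?addr_ge0// ltW.
Qed.

(** * Sign vectors as generators of the sliced cube *)

Definition sign_vector (R : realType) (m : nat) (A : {set 'I_6}) (B : {set 'I_m}) :
    'rV[R]_(6 + m) :=
  row_mx (\row_j (2 * (j \in A)%:R - 1)) (\row_j (2 * (j \in B)%:R - 1)).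

Definition balanced_signs (R : realType) (m : nat) : set 'rV[R]_(6 + m) :=
  [set x | exists (A : {set 'I_6}) (B : {set 'I_m}), #|A| = 3%N /\ x = sign_vector R A B].

Lemma sum_signs (R : realType) (A : {set 'I_6}) :
  \sum_j (2 * (j \in A)%:R - 1) = 2 * #|A|%:R - 6 :> R.
Proof.
rewrite sumrB -mulr_sumr sumr_const card_ord; congr (2 * _ - _).
by rewrite -natr_sum -sum1_card [in RHS]big_mkcond.
Qed.

Lemma balanced_signs_sub (R : realType) (m : nat) :
  @balanced_signs R m `<=` @sliced_cube R m.
Proof.
move=> _ [A [B [A3 ->]]]; split.
  move=> j; rewrite mxE; case: fintype.split => k; rewrite mxE; case: (_ \in _) => /=; lra.
rewrite six_sumE; under eq_bigr do rewrite row_mxEl mxE.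
by rewrite sum_signs A3; lra.
Qed.

(* Five signs have an odd sum, so a point of the slice cannot have exactly one
   free coordinate among the first six. *)
Lemma free_coords_parity (R : realType) (m : nat) (x : 'rV[R]_(6 + m)) :
  sliced_cube x -> free_coords x != finset.set0 ->
  (exists k, rshift 6 k \in free_coords x) \/
  exists j l : 'I_6, [/\ j != l, lshift m j \in free_coords x
    & lshift m l \in free_coords x].
Proof.
move=> [xb xs] /set0Pn[i ix].
have [k e|k e] := fintype.splitP i; last first.
  by left; exists k; rewrite (_ : rshift 6 k = i)//; exact/val_inj.
have {e} e : i = lshift m k by exact/val_inj.
right; apply: contrapT => none.
pose A := [set j | x 0 (lshift m j) == 1]%SET.
have xA j : j != k -> x 0 (lshift m j) = 2 * (j \in A)%:R - 1.
  move=> jk; rewrite inE; have [->|h1] := eqVneq (x 0 (lshift m j)) 1; first by rewrite ?eqxx /=; lra.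
  have [->|h2] := eqVneq (x 0 (lshift m j)) (-1); first by rewrite /=; lra.
  by exfalso; apply: none; exists j, k; split; rewrite -?e// inE h1 h2.
move: ix; rewrite e inE => /andP[h1 h2].
have /andP[b1 b2] := xb (lshift m k).
have kA : k \notin A by rewrite inE.
(* Since [k] is not in [A], [sum_signs] counts it as -1, which the term [x 0 (lshift m k) + 1]
   corrects. The strict bounds on this coordinate then force [#|A|] strictly between 2 and 3. *)
have : x 0 (lshift m k) + 1 + (2 * #|A|%:R - 6) = 0.
  rewrite -xs six_sumE -sum_signs (bigD1 k)//= [in RHS](bigD1 k)//= (negPf kA).
  rewrite mulr0 sub0r addrA addrK; congr (_ + _).
  by apply: eq_bigr => j jk; rewrite xA.
have {}b1 : -1 < x 0 (lshift m k) by rewrite lt_neqAle eq_sym h2.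
have {}b2 : x 0 (lshift m k) < 1 by rewrite lt_neqAle h1.
move=> e'; have c1 : 2%:R < #|A|%:R :> R by lra.
have c2 : #|A|%:R < 3%:R :> R by lra.
by move: c1 c2; rewrite !ltr_nat; lia.
Qed.

(** Induction on the number of free coordinates: a point with a free coordinate can be moved both
    ways along some [u], and lies between two points with fewer free coordinates. Without free
    coordinates it is a balanced sign vector. *)
Lemma sliced_cube_hull (R : realType) (m : nat) :
  @sliced_cube R m = convex_hull (@balanced_signs R m).
Proof.
apply/seteqP; split; last first.
  exact: convex_hull_min (@balanced_signs_sub _ _) (@sliced_cube_convex _ _).
move=> x; have [N] := ubnP #|free_coords x|; elim: N x => // N IH x xN Px.
have [/eqP x0|x0] := boolP (free_coords x == finset.set0); last first.
  suff [u [us u0 uf]] : exists u : 'rV[R]_(6 + m), [/\ evaluation (six_sum R m) u = 0,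
      u != 0 & forall j, u 0 j != 0 -> j \in free_coords x].
    have [a [a0 Pa fa]] := sliced_cube_move Px us u0 uf.
    have [||j|b [b0 Pb fb]] := @sliced_cube_move _ _ x (- u) Px.
    - by rewrite evaluationN us oppr0.
    - by rewrite oppr_eq0.
    - by rewrite mxE oppr_eq0; exact: uf.
    apply: (@convex_between _ _ _ _ u a b) => //.
    + exact: convex_hull_convex.
    + by apply: IH => //; exact: leq_trans fa xN.
    + by rewrite -scalerN; apply: IH => //; exact: leq_trans fb xN.
  (* A free cube coordinate moves alone; among the first six, two free coordinates move in opposite
     directions to keep the sum zero. *)
  have [[k kx]|[j [l [jl jx lx]]]] := free_coords_parity Px x0.
    exists (delta_mx 0 (rshift 6 k)); split.
    - rewrite six_sumE big1// => j _; rewrite mxE eqxx /=.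
      by rewrite eq_lrshift.
    - by apply/eqP => /rowP/(_ (rshift 6 k)); rewrite !mxE !eqxx => /eqP; rewrite oner_eq0.
    - move=> i; rewrite mxE eqxx /=; case: (i =P rshift 6 k) => [->//|_]; by rewrite eqxx.
  exists (delta_mx 0 (lshift m j) - delta_mx 0 (lshift m l)); split.
  - rewrite evaluationD evaluationN !six_sumE (bigD1 j)//= [X in _ - X](bigD1 l)//=.
    rewrite !mxE !eqxx /= !big1 ?addr0 ?subrr// => i ij;
      by rewrite mxE eqxx /= eq_lshift (negPf ij).
  - apply/eqP => /rowP/(_ (lshift m j)); rewrite !mxE !eqxx /= eq_lshift (negPf jl).
    by rewrite subr0 => /eqP; rewrite oner_eq0.
  - move=> i; rewrite !mxE eqxx /=; case: (i =P lshift m j) => [->//|_].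
    case: (i =P lshift m l) => [->//|_].
    by rewrite subrr eqxx.
apply: sub_convex_hull.
pose A := [set j | x 0 (lshift m j) == 1]%SET.
pose B := [set j | x 0 (rshift 6 j) == 1]%SET.
have pm j : x 0 j = 2 * (x 0 j == 1)%:R - 1.
  have : j \notin free_coords x by rewrite x0 inE.
  rewrite inE negb_and !negbK; have [->|h] := eqVneq (x 0 j) 1; first by rewrite ?eqxx /=; lra.
  by move=> /= /eqP ->; rewrite mulr0; lra.
have xE : x = sign_vector R A B.
  apply/rowP => j; rewrite mxE; case: (fintype.splitP j) => k jk; rewrite mxE inE pm.
    by congr (2 * (x 0 _ == _)%:R - _); exact/val_inj.
  by congr (2 * (x 0 _ == _)%:R - _); exact/val_inj.
exists A, B; split => //.
have := Px.2; rewrite six_sumE xE.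
under eq_bigr do rewrite row_mxEl mxE.
rewrite sum_signs => h; have : #|A|%:R = 3%:R :> R by lra.
by move/eqP; rewrite eqr_nat => /eqP.
Qed.

Lemma sliced_cube_polytope (R : realType) (m : nat) : polytope (@sliced_cube R m).
Proof.
rewrite sliced_cube_hull; exists (@balanced_signs R m) => //.
apply: (@sub_finite_set _ _ [set sign_vector R p.1 p.2 | p in
  [set: {set 'I_6} * {set 'I_m}]]).
  by move=> _ [A [B [_ ->]]]; exists (A, B).
exact/finite_image/finite_finset.
Qed.

Lemma sliced_cube_dim (R : realType) (m : nat) : has_dim (@sliced_cube R m) (5 + m).
Proof.
have -> : (5 + m)%N = \rank (kermx (six_sum R m)).
  rewrite mxrank_ker -mxrank_tr rank_rV; case: eqP => [/rowP/(_ (lshift m 0))|_].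
    by rewrite mxE col_mxEu !mxE => /eqP; rewrite oner_eq0.
  lia.
apply: (@has_dim_rank _ _ _ _ 0) => y; rewrite subr0 -evaluation_eq0; split.
  apply: (@affine_hull_min _ _ _ [set y | evaluation (six_sum R m) y = 0]).
    by move=> x [].
  exact: evaluation_level_closed.
(* [K] is positive and bounds every coordinate of [y], so [K^-1 *: y] lies in the slice. *)
move=> ys; pose K := 1 + \sum_j `|y 0 j|.
have K1 j : `|y 0 j| <= K.
  rewrite /K (bigD1 j)//= addrCA lerDl addr_ge0//.
  by apply: sumr_ge0.
have K0 : 0 < K by rewrite /K ltr_wpDr// sumr_ge0.
have -> : y = 0 + K *: (K^-1 *: y - 0).
  by rewrite add0r subr0 scalerA divff ?gt_eqF// scale1r.
apply: affine_hull_closed; apply: sub_affine_hull; try exact: sliced_cube0.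
split; last by rewrite evaluationZ ys mulr0.
move=> j; rewrite mxE -ler_norml normrM gtr0_norm ?invr_gt0//.
by rewrite mulrC ler_pdivrMr// mul1r.
Qed.

(** A vertex is the hull of the generators on it, hence one of them. There are C(6, 3) = 20 choices
    for [A] and [2 ^ m] for [B]. *)
Lemma sliced_cube_vertices (R : realType) (m : nat) :
  (f_num 0 (@sliced_cube R m) <= 20 * 2 ^ m)%N.
Proof.
pose I := ({A : {set 'I_6} | #|A| == 3%N} * {set 'I_m})%type.
have -> : (20 * 2 ^ m)%N = #|{: I}|.
  rewrite card_prod card_sig; congr (_ * _)%N.
    transitivity 'C(#|'I_6|, 3%N); first by rewrite card_ord.
    rewrite -card_draws; apply: eq_card => A.
    by rewrite !inE.
  transitivity (2 ^ #|[set: 'I_m]%SET|)%N; first by rewrite cardsT card_ord.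
  rewrite -card_powerset; apply: eq_card => B.
  by rewrite !inE finset.subsetT.
apply: (card_fset_set_le (g := fun p : I => [set sign_vector R (val p.1) p.2])).
move=> F [fF F0]; have [v Fv] := has_dim0_set1 F0.
move: (fF); rewrite sliced_cube_hull => /face_polytope FE.
have : F v by rewrite Fv.
rewrite {1}FE => -[[|k] [p [w [Ap _ w1 _]]]].
  by move: w1; rewrite big_ord0 => /esym/eqP; rewrite oner_eq0.
have [[A [B [A3 pE]]] Fp] := Ap ord0.
move/eqP: A3 => A3; exists (Sub A A3, B) => /=.
by rewrite Fv -pE; move: Fp; rewrite Fv => ->.
Qed.

(** * Facets of the sliced cube *)

Definition side (R : realType) (b : bool) : R := if b then 1 else -1.

(** If [F] lay in no side of the cube, averaging would give a point of [F] with all coordinates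
    free, and a supporting functional at such a point is constant on the slice. *)
Lemma sliced_cube_proper_face (R : realType) (m : nat) (F : set 'rV[R]_(6 + m)) :
  face (@sliced_cube R m) F -> (exists x, F x) -> F <> @sliced_cube R m ->
  exists p : 'I_(6 + m) * bool, forall x, F x -> x 0 p.1 = side R p.2.
Proof.
move=> fF [x0 Fx0] FP; apply: contrapT => none.
have FsubP := face_sub fF.
have Fc : convex F.
  move: fF => [c [b [_ ->]]]; exact: convex_level (@sliced_cube_convex _ _).
(* The sides are avoided one after another: a midpoint is off every side that one of its two ends is
   off. *)
have H (s : seq ('I_(6 + m) * bool)) :
    exists2 z, F z & forall p, p \in s -> z 0 p.1 != side R p.2.
  elim: s => [|p s [z Fz zs]]; first by exists x0.
  have [y Fy yp] : exists2 y, F y & y 0 p.1 != side R p.2.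
    apply: contrapT => h; apply: none; exists p => y Fy.
    by apply/eqP; apply: contrapT => /negP h'; apply: h; exists y.
  exists (2^-1 *: z + 2^-1 *: y); first by apply: Fc => //; lra.
  have mid q : z 0 q.1 != side R q.2 \/ y 0 q.1 != side R q.2 ->
      (2^-1 *: z + 2^-1 *: y) 0 q.1 != side R q.2.
    have [/(_ q.1)/andP[z1 z2] _] := FsubP _ Fz.
    have [/(_ q.1)/andP[y1 y2] _] := FsubP _ Fy.
    rewrite !mxE /side => h; apply/eqP; case: q.2 h => h e;
      by case: h => /eqP; apply; lra.
  by move=> q; rewrite inE => /orP[/eqP ->|/zs zq]; apply: mid; [right|left].
have [z Fz zs] := H (enum {: 'I_(6 + m) * bool}).
have zfree j : j \in free_coords z.
  rewrite inE (zs (j, true) (mem_enum _ _)).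
  exact: (zs (j, false) (mem_enum _ _)).
apply: FP; apply/seteqP; split => // p Pp.
have [->//|pz] := eqVneq p z.
(* Moving from [z] away from [p] stays in the slice for a while; as the functional is maximal at
   [z], it cannot be smaller at [p]. *)
have [||j _|a [a0 Pa _]] := @sliced_cube_move _ _ z (z - p) (FsubP _ Fz) => //.
- by rewrite evaluationD evaluationN (FsubP _ Fz).2 Pp.2 subrr.
- by rewrite subr_eq0 eq_sym.
move: fF Fz => [c [b [cb ->]]] [Pz zb]; split => //.
have := cb _ Pa; have := cb _ Pp; move: zb; rewrite -!/(evaluation _ _).
rewrite evaluationD evaluationZ evaluationD evaluationN => -> h1 h2.
by apply/eqP; rewrite eq_le h1 /=; nra.
Qed.

(** Among the first six coordinates there is one other than [j], which separates the two
    functionals. *)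
Lemma six_sum_coord_rank (R : realType) (m : nat) (j : 'I_(6 + m)) :
  \rank (row_mx (six_sum R m) (delta_mx j 0 : 'cV_(6 + m))) = 2%N.
Proof.
rewrite -mxrank_tr tr_row_mx; apply/eqP.
apply: (@inj_row_free _ (1 + 1)) => v; rewrite -(hsubmxK v) mul_row_col.
rewrite [lsubmx v]mx11_scalar [rsubmx v]mx11_scalar.
move: (lsubmx v 0 0) (rsubmx v 0 0) => a b; rewrite !mul_scalar_mx => /rowP e.
have [k kj] : exists k : 'I_6, lshift m k != j.
  case: (eqVneq (lshift m 0) j) => [<-|h]; last by exists 0.
  by exists 1; rewrite eq_lshift.
have a0 : a = 0.
  have := e (lshift m k); rewrite mxE [X in X + _]mxE [X in _ * X + _]mxE.
  rewrite /six_sum col_mxEu !mxE (negPf kj) /=.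
  by rewrite mulr1 mulr0 addr0.
have b0 : b = 0.
  by have := e j; rewrite a0 !mxE !eqxx /= mul0r add0r mulr1.
by rewrite a0 b0 !raddf0 row_mx0.
Qed.

(** A facet lies in some side. The sum and side equations cut out an affine space of dimension
    [4 + m], which must then be the affine hull of the facet and so determines it. *)
Lemma sliced_cube_facet (R : realType) (m : nat) (F : set 'rV[R]_(6 + m)) :
  face (@sliced_cube R m) F -> has_dim F (4 + m) ->
  exists p : 'I_(6 + m) * bool,
    F = [set x | sliced_cube x /\ x 0 p.1 = side R p.2].
Proof.
move=> fF Fd; have [x Fx] := has_dim_nonempty Fd.
have [|p Fp] := sliced_cube_proper_face fF (ex_intro _ x Fx).
  move=> FP; move: Fd; rewrite FP => /(has_dim_uniq (@sliced_cube_dim R m)); lia.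
exists p; pose N := kermx (row_mx (six_sum R m) (delta_mx p.1 0 : 'cV_(6 + m))).
have NE y : (y <= N)%MS <-> evaluation (six_sum R m) y = 0 /\ y 0 p.1 = 0.
  rewrite -(evaluation_delta p.1) !evaluation_eq0; split.
    move=> /sub_kermxP; rewrite mul_mx_row -row_mx0 => /eq_row_mx[h1 h2].
    by split; apply/sub_kermxP.
  by move=> [/sub_kermxP h1 /sub_kermxP h2]; apply/sub_kermxP; rewrite mul_mx_row h1 h2 row_mx0.
have FN : forall y, affine_hull F y <-> (y - x <= N)%MS.
  apply: (has_dim_sup Fd Fx) => [y Fy|]; last first.
    by rewrite mxrank_ker six_sum_coord_rank; lia.
  apply/NE; rewrite evaluationD evaluationN (face_sub fF Fx).2 (face_sub fF Fy).2.
  by rewrite !mxE !Fp// !subrr.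
rewrite [LHS](face_affine_hull fF); apply/seteqP; split => y [Py].
  move=> /FN/NE[_]; rewrite !mxE (Fp _ Fx) => e; split => //.
  by apply/eqP; rewrite -subr_eq0 e.
move=> yp; split => //; apply/FN/NE.
rewrite evaluationD evaluationN (face_sub fF Fx).2 Py.2 !mxE yp (Fp _ Fx).
by rewrite !subrr.
Qed.

Lemma sliced_cube_facets (R : realType) (m : nat) :
  (f_num (4 + m) (@sliced_cube R m) <= 2 * (6 + m))%N.
Proof.
have -> : (2 * (6 + m))%N = #|{: 'I_(6 + m) * bool}|.
  by rewrite card_prod card_ord card_bool mulnC.
apply: (card_fset_set_le (g := fun p : 'I_(6 + m) * bool =>
  [set x | @sliced_cube R m x /\ x 0 p.1 = side R p.2])).
by move=> F [fF Fd]; exact: sliced_cube_facet.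
Qed.

(** * Flag functionals *)

(** A chain with one member is a single face, and a face of dimension [i < d] is automatically
    proper. *)
Lemma flag_f_num_set1 (R : realType) (d n : nat) (i : 'I_d) (P : set 'rV[R]_n) :
  dpolytope d P -> flag_f_num [set i]%SET P = f_num i P.
Proof.
move=> [pP Pd]; rewrite /flag_f_num /f_num.
pose g (F : set 'rV[R]_n) :=
  [ffun _ : {j : 'I_d | j \in [set i]%SET} => F] : {ffun _ -> set 'rV[R]_n}.
pose i0 : {j : 'I_d | j \in [set i]%SET} := exist _ i (set11 i).
have iE (j : {j : 'I_d | j \in [set i]%SET}) : j = i0.
  by apply/val_inj/eqP; have := valP j; rewrite inE.
have -> : [set F | @flag_chain R d n [set i]%SET P F] =
    g @` [set F | face P F /\ has_dim F i].
  apply/seteqP; split.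
    move=> F [Fi _]; exists (F i0); first by case: (Fi i0).
    by apply/ffunP => j; rewrite ffunE (iE j).
  move=> _ [F [fF Fi] <-]; split => [j|j l]; last first.
    by rewrite (iE j) (iE l) ltnn.
  rewrite ffunE (iE j); split => //; rewrite properEneq; split; last exact: face_sub.
  apply/eqP => FP; move: Fi; rewrite FP => /(has_dim_uniq Pd) /= e.
  by have := ltn_ord i; rewrite -e ltnn.
rewrite fset_set_image; last exact: finite_faces_dim.
by rewrite card_imfset// => F G /ffunP/(_ i0); rewrite !ffunE.
Qed.

Lemma flag_functional_indicator (R : realType) (d n : nat) (i : 'I_d)
    (P : set 'rV[R]_n) :
  dpolytope d P ->
  flag_functional (fun S => (S == [set i]%SET)%:R) P = (f_num i P)%:R.
Proof.
move=> dP; rewrite /flag_functional (bigD1 [set i]%SET)//= eqxx mul1r.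
rewrite big1 ?addr0 ?flag_f_num_set1// => S /negPf ->.
by rewrite mul0r.
Qed.

Lemma sliced_cube_beats_hanner (R : realType) (m n : nat) (H : set 'rV[R]_n) :
  dpolytope (5 + m) H -> hanner H ->
  exists i : 'I_(5 + m), (f_num i (@sliced_cube R m) < f_num i H)%N.
Proof.
move=> [_ Hd] /hanner_face_bound[e [_ _ He [_ _ _ bnd]]].
have eE : e = (4 + m)%N by have := has_dim_uniq Hd He; lia.
subst e.
have lt4 : (4 + m < 5 + m)%N by [].
have [h|h] := leqP (f_num (4 + m) H) (f_num (4 + m) (@sliced_cube R m)); last first.
  by exists (Ordinal lt4).
(* The facet bound [2 * (6 + m)] equals [2 * (5 + m) + 2], the threshold in the last clause of
   [hanner_bound]. *)
exists ord0; have := sliced_cube_facets R m; have := sliced_cube_vertices R m.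
move=> /= hV hF; have := bnd ltac:(lia).
rewrite -[(4 + m).+1]/(5 + m)%N expnD -[(2 ^ 5)%N]/32%N.
have : (0 < 2 ^ m)%N by rewrite expn_gt0.
lia.
Qed.

Theorem theorem1p3 (R : realType) (d : nat) (hd : (5 <= d)%N) :
  (exists (n : nat) (P : set 'rV[R]_n),
     [/\ dpolytope d P, centrally_symmetric P &
       forall (m : nat) (H : set 'rV[R]_m), dpolytope d H -> hanner H ->
         exists i : 'I_d, (f_num i P < f_num i H)%N]) /\
  (exists (n : nat) (P : set 'rV[R]_n),
     [/\ dpolytope d P, centrally_symmetric P &
       forall (m : nat) (H : set 'rV[R]_m), dpolytope d H -> hanner H ->
         exists alpha : {set 'I_d} -> R,
           @nonneg_functionals R d alpha /\
           flag_functional alpha P < flag_functional alpha H]).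
Proof.
have [m dE] : exists m, d = (5 + m)%N by exists (d - 5)%N; lia.
subst d.
have dP : dpolytope (5 + m) (@sliced_cube R m).
  by split; [exact: sliced_cube_polytope|exact: sliced_cube_dim].
split; exists (6 + m)%N, (@sliced_cube R m); split => //;
  try exact: sliced_cube_symmetric.
- by move=> n H; exact: sliced_cube_beats_hanner.
- move=> n H dH hH; have [i lt_i] := sliced_cube_beats_hanner dH hH.
  exists (fun S => (S == [set i]%SET)%:R); split; last first.
    by rewrite !flag_functional_indicator// ltr_nat.
  by move=> k Q dQ; rewrite flag_functional_indicator// ler0n.
Qed.
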